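(* For every finite simple planar graph $G$, $$\mathrm{fvs}(G)\le F_{\max}(G).$$
   Context: A feedback vertex set of a graph $G$ is a set $S\subseteq V(G)$ such that $G-S$ (the graph obtained by deleting the vertices of $S$) is a forest; $\mathrm{fvs}(G)$ is the minimum size of a feedback vertex set of $G$. A signature on $G$ is a subset $\Sigma\subseteq E(G)$ (the set of negative edges); the pair $(G,\Sigma)$ is a signed graph. For $X\subseteq V(G)$, $\delta_G(X)$ denotes the set of edges with exactly one end in $X$, called an edge cut. Two signatures $\Sigma,\Sigma'$ on $G$ are switching equivalent if $\Sigma'=\Sigma\,\Delta\,\delta_G(X)$ for some $X\subseteq V(G)$, where $\Delta$ is symmetric difference. The frustration index of $(G,\Sigma)$ is $F(G,\Sigma)=\min\{|\Sigma'|:\Sigma'\text{ is switching equivalent to }\Sigma\}$. The maximum frustration index of $G$ is $F_{\max}(G)=\max\{F(G,\Sigma):\Sigma\subseteq E(G)\}$. *)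

(* Defs.v *)
From HB Require Import structures.
From mathcomp Require Import all_boot all_order all_algebra.
From mathcomp Require Import all_classical all_reals all_analysis.

Set Implicit Arguments.
Unset Strict Implicit.
Unset Printing Implicit Defensive.

Import Order.TTheory GRing.Theory Num.Theory.
Import numFieldNormedType.Exports.

(** A finite simple graph is a finite type [V] of vertices with a symmetric
    irreflexive adjacency relation [e : rel V]; an edge is the two-element set
    of its ends.  The set notations below are those of [finset]. *)

Section Graph.
Variables (V : finType) (e : rel V).
Implicit Types (S X : {set V}) (Sg : {set {set V}}).

Definition edges : {set {set V}} :=
  [set E : {set V} | [exists x, exists y, e x y && (E == [set x; y])]].

(** [A] induces a forest: no (simple) cycle of the graph, necessarily of length
    at least 3, has all its vertices in [A]. *)
Definition induces_forest (A : {set V}) : Prop :=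
  forall c : seq V, {subset c <= A} -> 2 < size c -> ~ ucycle e c.

Definition feedback_vertex_set S : Prop := induces_forest (~: S).

Lemma feedback_vertex_setT : feedback_vertex_set [set: V].
Proof.
move=> [//|x c] cS _ _.
by have := cS x (mem_head x c); rewrite !inE.
Qed.

Definition fvs : nat :=
  #|[arg min_(S < [set: V] | `[< feedback_vertex_set S >]) #|S|]|.

Lemma fvsP :
  (exists2 S, feedback_vertex_set S & #|S| = fvs) /\
  (forall S, feedback_vertex_set S -> fvs <= #|S|).
Proof.
rewrite /fvs; case: arg_minnP => [|S /asboolP fS minS].
  exact/asboolP/feedback_vertex_setT.
by split=> [|S' fS']; [exists S | apply: minS; apply/asboolP].
Qed.

Definition edge_cut X : {set {set V}} := [set E in edges | #|E :&: X| == 1].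

Definition symdiff (T : finType) (A B : {set T}) : {set T} :=
  (A :\: B) :|: (B :\: A).

Definition switching_equivalent Sg Sg' : bool :=
  [exists X : {set V}, Sg' == symdiff Sg (edge_cut X)].

Lemma switching_equivalent_refl Sg : switching_equivalent Sg Sg.
Proof.
apply/existsP; exists finset.set0; apply/eqP/setP => E.
by rewrite !inE finset.setI0 cards0 andbF andbF orbF.
Qed.

Definition frustration_index Sg : nat :=
  #|[arg min_(Sg' < Sg | switching_equivalent Sg Sg') #|Sg'|]|.

Lemma frustration_indexP Sg :
  (exists2 Sg', switching_equivalent Sg Sg' & #|Sg'| = frustration_index Sg) /\
  (forall Sg', switching_equivalent Sg Sg' -> frustration_index Sg <= #|Sg'|).
Proof.
rewrite /frustration_index.
case: arg_minnP => [|Sg' eqS minS]; first exact: switching_equivalent_refl.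
by split=> //; exists Sg'.
Qed.

Definition max_frustration_index : nat :=
  \max_(Sg : {set {set V}} | Sg \subset edges) frustration_index Sg.

End Graph.

Section Planarity.
Local Open Scope classical_set_scope.
Local Open Scope ring_scope.
Variables (R : realType) (V : finType) (e : rel V).

(** A curve is parametrized by [0, 1]; its values outside [0, 1] are
    irrelevant. *)
Definition simple_arc (g : R -> R * R) : Prop :=
  {within `[0, 1], continuous g} /\ {in `[0, 1] &, injective g}.

(** Each edge has a single arc, traversed in either direction. *)
Record plane_drawing (pos : V -> R * R) (arc : {set V} -> R -> R * R) : Prop :=
  PlaneDrawing {
  pos_inj : injective pos;
  arc_simple : forall E, E \in edges e -> simple_arc (arc E);
  arc_ends : forall x y, e x y ->
    (arc [set x; y]%SET 0 = pos x /\ arc [set x; y]%SET 1 = pos y) \/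
    (arc [set x; y]%SET 0 = pos y /\ arc [set x; y]%SET 1 = pos x);
  arc_avoids_vertices : forall E v t,
    E \in edges e -> 0 < t < 1 -> arc E t <> pos v;
  arc_disjoint : forall E E' t t',
    E \in edges e -> E' \in edges e -> E <> E' ->
    0 < t < 1 -> 0 < t' < 1 -> arc E t <> arc E' t' }.

Definition planar : Prop := exists pos arc, plane_drawing pos arc.

End Planarity.

Arguments planar R {V} e.

(* Main.v *)
From mathcomp Require Import all_boot zify.
Require Import Defs.

(** Call an edge set of a multigraph even if all its degrees are even. Let [H]
    be an abstract dual of [G]: a multigraph on the edges of [G] whose even sets
    are the cuts of [G]. Switching adds even sets of [H], so a signature [J] is
    a smallest one in its class exactly when no even set of [H] has more than
    half of its edges in [J]; such a [J] is called a join. Hence the maximum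
    frustration index of [G] is the largest size of a join of [H], and it
    suffices to find a join with at least fvs(G) edges.

    Upper bounds on fvs(G) come from cuts. Deleting a cut with l edges lowers
    the feedback vertex number by at most l/2, because two forests with l edges
    between them become one forest after the deletion of l/2 vertices
    ([merge_forests]); deleting one edge lowers it by at most 1. In [H] deleted
    edges are contracted, so these are the costs of contracting an even set and
    an edge. An odd ear with 2q + 1 edges costs only q while it absorbs 2q
    vertices: half a unit for each vertex ([ear_growth]). When [H] has an odd
    ear decomposition, it is contracted at the cost of a near-perfect matching,
    and such a matching is a join.

    In general this is done piece by piece, as in the theorem of A. Frank that
    equates the largest size of a join with the least cost of an ear
    decomposition; only the inequality that is needed is proved. A set of
    vertices [A] is chosen as in the Gallai-Edmonds theorem, so that the
    components left by [A] have odd ear decompositions and a maximum matching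
    sends [A] into distinct components ([gallai_edmonds]). A minimal part [A']
    of [A] that contains all neighbours of the components matched to it forms,
    with these components, a set [Z] that can be contracted at cost #|Z|/2, and
    that carries a perfect matching ([core_contractible]). Only vertices of [A']
    have neighbours outside [Z], so every even set of [H] has at most half of
    its edges within [Z] in this matching, and it may be added to any join of
    [H]/[Z]. Induction gives [large_join].

    Planarity is used to construct [H]. The thirds of the arcs next to a vertex,
    and the middle thirds, are compact connected sets; replacing them by the
    cells of a fine square grid that they meet shows that [G] is a minor of a
    grid ([plane_thick_drawing], [thick_drawing_minor]). The grid has the
    obvious dual, in which an even set is a cut because a closed discrete 1-form
    is exact ([even_grid_coloring]). Deleting and contracting edges turns this
    dual into an abstract dual of [G] ([grid_minor_dual]). *)

Set Implicit Arguments.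
Unset Strict Implicit.
Unset Printing Implicit Defensive.

(** * Even edge sets of a multigraph and the cost of contracting them *)

Lemma in_symdiff (T : finType) (A B : {set T}) x :
  (x \in symdiff A B) = (x \in A) (+) (x \in B).
Proof. by rewrite !inE; case: (x \in A); case: (x \in B). Qed.

Section Multigraph.
Variables (Ed W : finType) (s t : Ed -> W).
Implicit Types (F C Q : {set Ed}) (Y Z U : {set W}) (E : Ed).

Definition incident E w : bool := (s E == w) (+) (t E == w).
(** The parity of the degree of [w] in [C]; a loop contributes nothing. *)
Definition boundary C w : bool := \big[addb/false]_(E in C) incident E w.
Definition even_set C : Prop := forall w, boundary C w = false.

Definition joins E : rel W := fun x y =>
  ((s E == x) && (t E == y)) || ((s E == y) && (t E == x)).
Definition link F : rel W := fun x y => [exists E in F, joins E x y].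
Definition spanned_edges Y : {set Ed} := [set E | (s E \in Y) && (t E \in Y)].
Definition connected_set Y : Prop :=
  {in Y &, forall x y, connect (link (spanned_edges Y)) x y}.

Lemma boundary_symdiff C C' w :
  boundary (symdiff C C') w = boundary C w (+) boundary C' w.
Proof.
rewrite /boundary big_mkcond [X in X (+) _]big_mkcond [X in _ (+) X]big_mkcond.
rewrite -big_split /=; apply: eq_bigr => E _.
by rewrite in_symdiff; case: (E \in C); case: (E \in C') => //=; rewrite ?addbb ?addbF.
Qed.

Lemma boundary0 w : boundary set0 w = false.
Proof. by rewrite /boundary big_set0. Qed.

Lemma boundary1 E w : boundary [set E] w = incident E w.
Proof. by rewrite /boundary big_set1. Qed.

Lemma boundaryU1 C E w : E \notin C ->
  boundary (E |: C) w = incident E w (+) boundary C w.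
Proof. by move=> EC; rewrite /boundary big_setU1. Qed.

Lemma joins_sym E x y : joins E x y = joins E y x.
Proof. by rewrite /joins orbC. Qed.

Lemma joins_incident E x y : joins E x y ->
  forall w, incident E w = (w == x) (+) (w == y).
Proof.
by case/orP => /andP[/eqP <- /eqP <-] w; rewrite /incident ![w == _]eq_sym // addbC.
Qed.

Lemma joins_ends E x y Y : joins E x y ->
  (E \in spanned_edges Y) = (x \in Y) && (y \in Y).
Proof. by rewrite inE; case/orP => /andP[/eqP -> /eqP ->] //; rewrite andbC. Qed.

Lemma link_sym F : symmetric (link F).
Proof. by move=> x y; apply: eq_existsb => E; rewrite joins_sym. Qed.

Lemma connect_link_sym F : connect_sym (link F).
Proof. exact/sym_connect_sym/link_sym. Qed.

Lemma linkI F E x y : E \in F -> joins E x y -> link F x y.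
Proof. by move=> EF j; apply/existsP; exists E; rewrite EF. Qed.

Lemma connect_link_mono F F' x y : F \subset F' ->
  connect (link F) x y -> connect (link F') x y.
Proof.
move=> sub; apply: connect_sub => a b /existsP[E /andP[EF j]].
by apply/connect1/(linkI _ j)/(subsetP sub).
Qed.

Lemma spannedS Y Z : Y \subset Z -> spanned_edges Y \subset spanned_edges Z.
Proof.
move=> /subsetP sub; apply/subsetP => E; rewrite !inE => /andP[a b].
by rewrite !sub.
Qed.

Lemma path_boundary F x y : connect (link F) x y ->
  exists2 C : {set Ed}, C \subset F & forall w, boundary C w = (w == x) (+) (w == y).
Proof.
case/connectP => p + ->; elim: p x => [|z p IH] x /=.
  by exists set0; [exact: sub0set | move=> w; rewrite boundary0 addbb].
case/andP => /existsP[E /andP[EF j]] /IH[C CF bC].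
exists (symdiff [set E] C).
  by rewrite subUset !subDset !subsetU ?CF ?sub1set ?EF ?orbT.
move=> w; rewrite boundary_symdiff boundary1 (joins_incident j) bC.
by case: (w == x); case: (w == z); case: (w == last z p).
Qed.

End Multigraph.

(** Edges whose ends are identified by [k] become loops and cancel. *)
Lemma boundary_comp (Ed W W' : finType) (s t : Ed -> W) (k : W -> W') C w' :
  boundary (k \o s) (k \o t) C w' =
    \big[addb/false]_(w | k w == w') boundary s t C w.
Proof.
rewrite /boundary exchange_big /=; apply: eq_bigr => E _.
rewrite /incident big_split /=; congr (_ (+) _).
  case: eqP => [<-|ne]; last first.
    by rewrite big1 // => w /eqP kw; apply/eqP => e; apply: ne; rewrite /= e.
  rewrite (bigD1 (s E)) //= eqxx big1 // => w /andP[_ ne].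
  by rewrite eq_sym (negPf ne).
case: eqP => [<-|ne]; last first.
  by rewrite big1 // => w /eqP kw; apply/eqP => e; apply: ne; rewrite /= e.
rewrite (bigD1 (t E)) //= eqxx big1 // => w /andP[_ ne].
by rewrite eq_sym (negPf ne).
Qed.

(** The even sets of a contracted graph are the traces of the even sets of the
    graph: the vertices of odd degree come in pairs within the fibres of [k],
    and the vertices of a pair are joined by a path of contracted edges. *)
Lemma even_completion (Ed W W' : finType) (s t : Ed -> W) (k : W -> W')
    (F C : {set Ed}) :
  (forall x y, k x = k y -> connect (link s t F) x y) ->
  even_set (k \o s) (k \o t) C ->
  exists2 C' : {set Ed}, C' \subset F & even_set s t (symdiff C C').
Proof.
move=> kF.
move Dn: #|[set w | boundary s t C w]| => n.
elim/ltn_ind: n C Dn => n IH C Dn evC.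
case: (set_0Vmem [set w | boundary s t C w]) => [T0|[x]].
  exists set0; first exact: sub0set.
  move=> w; rewrite boundary_symdiff boundary0 addbF.
  by move/setP/(_ w): T0; rewrite !inE.
rewrite inE => bx.
have [y /andP[/eqP kxy nyx] By] :
    exists2 y, (k y == k x) && (y != x) & boundary s t C y.
  have := evC (k x); rewrite boundary_comp (bigD1 x) //= bx /= => /negbFE.
  move=> h; case: (pickP [pred y | (k y == k x) && (y != x) && boundary s t C y]).
    by move=> y /= /andP[]; exists y.
  move=> no; move: h; rewrite big1 // => y kx; have := no y.
  by rewrite /= kx.
have [D DF bD] := path_boundary (kF _ _ kxy).
have bE w : boundary s t (symdiff C D) w =
    boundary s t C w && (w != x) && (w != y).
  rewrite boundary_symdiff bD.
  case: (eqVneq w y) => [->|_]; first by rewrite By (negPf nyx).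
  by case: (eqVneq w x) => [->|_]; rewrite ?bx //= addbF !andbT.
have [||D' D'F ev] := IH _ _ (symdiff C D) erefl.
- rewrite -Dn; apply: proper_card; apply/properP; split.
    by apply/subsetP => w; rewrite !inE bE => /andP[/andP[]].
  by exists x; rewrite !inE ?bE // eqxx andbF.
- move=> w'; rewrite boundary_comp.
  under eq_bigr do rewrite boundary_symdiff bD.
  rewrite !big_split /= -boundary_comp evC /=.
  have one z : \big[addb/false]_(w | k w == w') (w == z) = (k z == w').
    case: eqP => [<-|ne]; last first.
      by rewrite big1 // => w /eqP kw; apply/eqP => e; apply: ne; rewrite -kw e.
    rewrite (bigD1 z) //= eqxx big1 // => w /andP[_ ne].
    exact/negbTE.
  by rewrite !one kxy addbb.
exists (symdiff D D').
  by rewrite subUset !subDset !subsetU ?DF ?D'F ?orbT.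
by move=> w; have := ev w; rewrite !boundary_symdiff addbA.
Qed.

Section EarCost.
Variables (Ed W : finType) (s t : Ed -> W) (g : {set Ed} -> nat).
Implicit Types (F C L Q : {set Ed}) (Y Z U : {set W}) (E : Ed).

(** What is kept of the feedback vertex number: [g F] stands for its value after
    the deletion of [F] from a graph of which [(s, t)] is an abstract dual, in
    which [F] is thus contracted and the even sets are cuts. *)
Definition ear_cost : Prop :=
  (forall F E, g F <= (g (E |: F)).+1) /\
  (forall F C, even_set s t C -> g F <= g (F :|: C) + #|C :\: F|./2).

Hypothesis gP : ear_cost.

(** Edges that are contracted already are free. *)
Lemma ear_cost_mod F C :
  (exists2 C' : {set Ed}, C' \subset F & even_set s t (symdiff C C')) ->
  g F <= g (F :|: C) + #|C :\: F|./2.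
Proof.
case=> C' C'F ev; have := gP.2 F _ ev.
have -> : F :|: symdiff C C' = F :|: C.
  apply/setP => E; rewrite !inE; have := subsetP C'F E.
  by case: (E \in C'); case: (E \in C); case: (E \in F) => // /(_ isT).
have -> // : symdiff C C' :\: F = C :\: F.
apply/setP => E; rewrite !inE; have := subsetP C'F E.
by case: (E \in C'); case: (E \in C); case: (E \in F) => // /(_ isT).
Qed.

(** Once its ends are connected by contracted edges, an edge is a loop, hence an
    even set with one element, of cost 1./2 = 0. *)
Lemma ear_cost_loops F L :
  {in L, forall E, connect (link s t F) (s E) (t E)} -> g F <= g (F :|: L).
Proof.
move: {2}#|L| (leqnn #|L|) => n.
elim: n F L => [|n IH] F L.
  by rewrite leqn0 cards_eq0 => /eqP->; rewrite setU0.
case: (set_0Vmem L) => [->|[E EL]]; first by rewrite setU0.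
move=> cL h; have [C' C'F bC'] := path_boundary (h E EL).
have step : g F <= g (F :|: [set E]).
  have := @ear_cost_mod F [set E]; move=> /(_ _)/leq_trans->//.
    exists C' => // w; rewrite boundary_symdiff boundary1 bC' /incident.
    by rewrite ![w == _]eq_sym addbb.
  have : #|[set E] :\: F| <= 1 by rewrite -(cards1 E) subset_leq_card ?subsetDl.
  by lia.
apply: leq_trans step _.
have -> : F :|: L = (F :|: [set E]) :|: (L :\ E).
  by rewrite -setUA setD1K.
apply: IH; first by move: cL; rewrite (cardsD1 E L) EL.
move=> E' /setD1P[_ /h]; apply: connect_link_mono; exact: subsetUl.
Qed.

Lemma connected_set1 x : connected_set s t [set x].
Proof. by move=> a b /set1P-> /set1P->; exact: connect0. Qed.

End EarCost.

(** Contracting the fibres of [k] beforehand gives a cost of the same kind, which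
    allows induction by contraction. *)
Lemma ear_cost_contract (Ed W W' : finType) (s t : Ed -> W) (k : W -> W') g
    (F0 : {set Ed}) :
  ear_cost s t g -> (forall x y, k x = k y -> connect (link s t F0) x y) ->
  ear_cost (k \o s) (k \o t) (fun F => g (F :|: F0)).
Proof.
move=> gP kF; split=> [F E|F C evC]; first by rewrite -setUA; exact: gP.1.
have [C' C'F ev] := even_completion kF evC.
have := @ear_cost_mod _ _ _ _ _ gP (F :|: F0) C.
rewrite setUAC => /(_ _)/leq_trans-> //.
  by exists C' => //; apply: subset_trans C'F (subsetUr _ _).
by rewrite leq_add2l half_leq // subset_leq_card // setDS ?subsetUl.
Qed.

(** * Odd ears *)

Section Ears.
Variables (Ed W : finType) (s t : Ed -> W) (g : {set Ed} -> nat).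
Hypothesis gP : ear_cost s t g.
Implicit Types (F C L Q : {set Ed}) (Y Z U : {set W}) (E : Ed).

Local Notation adj := (link s t [set: Ed]).
Local Notation spanned := (spanned_edges s t).
Local Notation connected_set := (connected_set s t).

Lemma adjP x y : reflect (exists E, joins s t E x y) (adj x y).
Proof.
apply: (iffP existsP) => [[E /andP[_ j]]|[E j]]; exists E => //.
by rewrite inE.
Qed.

Lemma adj_sym x y : adj x y = adj y x. Proof. exact: link_sym. Qed.

Variable m : W -> W.
Hypothesis mK : involutive m.

Definition closed_under Y : Prop := {in Y, forall y, m y \in Y}.

(** A walk from [Y] back to [Y] through the fresh pairs [u i], [m (u i)] for
    [i < q]: it has 2q + 1 edges and 2q inner vertices. *)
Definition alternating_ear Y (u : nat -> W) q : Prop :=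
  [/\ 0 < q, exists2 y, y \in Y & adj y (u 0), u q \in Y &
    forall i, i < q -> [/\ u i \notin Y, adj (u i) (m (u i)),
      adj (m (u i)) (u i.+1) &
      forall j, j < q -> (u i = u j -> i = j) /\ u i <> m (u j)]].

Fixpoint ear_hull Y (u : nat -> W) i : {set W} :=
  if i is j.+1 then u j |: (m (u j) |: ear_hull Y u j) else Y.

Lemma mem_ear_hull Y u i w : w \in ear_hull Y u i ->
  w \in Y \/ exists2 j, j < i & w = u j \/ w = m (u j).
Proof.
elim: i => [|i IH] /=; first by left.
case/setU1P => [->|]; first by right; exists i; [|left].
case/setU1P => [->|]; first by right; exists i; [|right].
by case/IH => [|[j ji e]]; [left | right; exists j; first exact: ltnW].
Qed.

Lemma ear_hull_mono Y u i j : i <= j -> ear_hull Y u i \subset ear_hull Y u j.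
Proof.
move=> /subnK <-; elim: (j - i) => [//|k IH].
by rewrite addSn /=; apply: subset_trans IH _; rewrite setUA subsetUr.
Qed.

Section OneEar.
Variables (Y : {set W}) (u : nat -> W) (q : nat).
Hypotheses (mY : closed_under Y) (ear : alternating_ear Y u q).

Lemma ear_out i : i < q -> (u i \notin Y) /\ (m (u i) \notin Y).
Proof.
move=> iq; case: ear => _ _ _ /(_ i iq)[uY _ _ _]; split=> //.
by apply: contra uY => /mY; rewrite mK.
Qed.

Lemma ear_fresh i : i < q ->
  [/\ m (u i) \notin ear_hull Y u i, u i \notin ear_hull Y u i & u i <> m (u i)].
Proof.
move=> iq; have [uY vY] := ear_out iq.
case: ear => _ _ _ h; split; last by case: (h i iq) => _ _ _ /(_ i iq)[].
  apply/negP => /mem_ear_hull[|[j ji [e|e]]]; first by rewrite (negPf vY).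
    by case: (h j (ltn_trans ji iq)) => _ _ _ /(_ i iq)[_]; rewrite e.
  case: (h i iq) => _ _ _ /(_ j (ltn_trans ji iq))[+ _].
  by rewrite -[u i]mK e mK => /(_ erefl) ij; rewrite ij ltnn in ji.
apply/negP => /mem_ear_hull[|[j ji [e|e]]]; first by rewrite (negPf uY).
  case: (h i iq) => _ _ _ /(_ j (ltn_trans ji iq))[+ _] => /(_ e) ij.
  by rewrite ij ltnn in ji.
by case: (h i iq) => _ _ _ /(_ j (ltn_trans ji iq))[_].
Qed.

Lemma card_ear_hull : #|ear_hull Y u q| = #|Y| + q.*2.
Proof.
suff: forall i, i <= q -> #|ear_hull Y u i| = #|Y| + i.*2 by apply.
elim=> [|i IH] iq; first by rewrite addn0.
have [vh uh uv] := ear_fresh iq.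
rewrite /= cardsU1 in_setU1 negb_or uh cardsU1 vh /= (IH (ltnW iq)).
by move/eqP: uv => ->; lia.
Qed.

Lemma closed_ear_hull : closed_under (ear_hull Y u q).
Proof.
elim: (q) => [|i IH] /=; first exact: mY.
move=> y /setU1P[->|/setU1P[->|/IH h]]; rewrite ?mK !inE ?eqxx ?orbT //.
by rewrite h !orbT.
Qed.

(** Every pair brings two edges at the fresh vertex [m (u i)], which no earlier
    edge contains. Thus no edge occurs twice and the boundaries add up. *)
Lemma ear_edges : exists2 y, y \in Y & forall i, i <= q ->
  exists C : {set Ed}, [/\ #|C| <= i.*2.+1,
    forall w, boundary s t C w = (w == y) (+) (w == u i),
    C \subset spanned (u i |: ear_hull Y u i),
    connect (link s t C) y (u i) &
    forall j, j < i -> connect (link s t C) y (u j)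
                    /\ connect (link s t C) y (m (u j))].
Proof.
case: (ear) => q0 [y yY /adjP[E0 jE0]] uqY h; exists y => //.
elim=> [|i IH] iq.
  exists [set E0]; split=> //.
  - by rewrite cards1.
  - by move=> w; rewrite boundary1 (joins_incident jE0).
  - by rewrite sub1set (joins_ends _ jE0) !inE yY eqxx orbT.
  - by apply/connect1/(linkI _ jE0)/set11.
have [C [cC bC sC kC kk]] := IH (ltnW iq).
have [vh uh uv] := ear_fresh iq.
have [uY /adjP[A jA] /adjP[B jB] hh] := h i iq.
have noV E : E \in C -> forall x, ~~ joins s t E (m (u i)) x.
  move=> /(subsetP sC) EC x; apply/negP => j; move: EC.
  rewrite (joins_ends _ j) !inE (negPf vh) orbF.
  by move/eqP: uv; rewrite eq_sym => /negPf ->.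
have AC : A \notin C.
  by apply: contraL jA => /noV /(_ (u i)); rewrite joins_sym.
have BC : B \notin A |: C.
  rewrite !inE negb_or; apply/andP; split; last first.
    by apply: contraL jB => /noV /(_ (u i.+1)).
  apply/eqP => e; rewrite e in jB.
  have e1 : u i.+1 = u i.
    have := joins_incident jA (u i); rewrite (joins_incident jB).
    by move/eqP/negPf: uv => ->; rewrite eqxx /= => /eqP.
  have [lt|] := ltnP i.+1 q.
    have [_ _ _ /(_ i iq)[/(_ e1)/eqP]] := h _ lt.
    by rewrite eqn_leq ltnn.
  rewrite leq_eqVlt ltnS leqNgt iq orbF => /eqP e2.
  by move: uqY; rewrite e2 e1 (negPf uY).
exists (B |: (A |: C)).
have subC : C \subset B |: (A |: C) by rewrite setUA subsetUr.
have kA : connect (link s t (B |: (A |: C))) y (m (u i)).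
  apply: connect_trans (connect_link_mono subC kC) _.
  by apply/connect1/(linkI _ jA); rewrite !inE eqxx orbT.
split.
- by rewrite cardsU1 BC cardsU1 AC doubleS !add1n !ltnS.
- move=> w; rewrite boundaryU1 // boundaryU1 // (joins_incident jA).
  rewrite (joins_incident jB) bC.
  by case: (w == y); case: (w == u i); case: (w == m (u i)); case: (w == u i.+1).
- rewrite !subUset !sub1set (joins_ends _ jA) (joins_ends _ jB).
  rewrite !in_setU1 !eqxx ?orbT /=; apply: subset_trans sC _.
  by apply: spannedS => /=; rewrite subUset sub1set !inE eqxx ?orbT /= !setUA subsetUr.
- by apply: connect_trans kA _; apply/connect1/(linkI _ jB)/setU11.
move=> j; rewrite ltnS leq_eqVlt => /orP[/eqP->|/kk[k1 k2]].
  by split=> //; exact: connect_link_mono kC.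
by split; exact: connect_link_mono subC _.
Qed.

(** The ear becomes an even set when its two ends are linked inside [Y]. It has
    at most 2q + 1 edges outside [Y], half of which, rounded down, is [q]. *)
Lemma ear_step : connected_set Y ->
  connected_set (ear_hull Y u q) /\
  forall F, g (F :|: spanned Y) <= g (F :|: spanned (ear_hull Y u q)) + q.
Proof.
move=> cY; have [y yY /(_ q (leqnn q))[C [cC bC sC kC kk]]] := ear_edges.
have uqY : u q \in Y by case: ear.
set U := ear_hull Y u q.
have YU : Y \subset U := ear_hull_mono Y u (leq0n q).
have sCU : C \subset spanned U.
  by move: sC; rewrite (setUidPr _) // sub1set (subsetP YU).
have cU x : x \in U -> connect (link s t (spanned Y :|: C)) y x.
  case/mem_ear_hull => [xY|[j jq]].
    by apply: connect_link_mono (cY y x yY xY); exact: subsetUl.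
  case: (kk j jq) => [k1 k2] [->|->].
    by apply: connect_link_mono k1; exact: subsetUr.
  by apply: connect_link_mono k2; exact: subsetUr.
have cUU x x' : x \in U -> x' \in U -> connect (link s t (spanned Y :|: C)) x x'.
  move=> xU x'U; apply: connect_trans (cU _ x'U).
  by rewrite connect_link_sym; exact: cU.
split.
  move=> x x' xU x'U; apply: connect_link_mono (cUU _ _ xU x'U).
  by rewrite subUset sCU spannedS.
move=> F; have [C' C'Y bC'] := path_boundary (cY _ _ yY uqY).
have := ear_cost_mod gP (F := F :|: spanned Y) (C := C).
move=> /(_ _)/leq_trans-> //.
  exists C'; first by apply: subset_trans C'Y (subsetUr _ _).
  by move=> w; rewrite boundary_symdiff bC bC' addbb.
apply: leq_add; last first.
  have : #|C :\: (F :|: spanned Y)| <= #|C| by rewrite subset_leq_card ?subsetDl.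
  by lia.
have := ear_cost_loops gP (F := F :|: spanned Y :|: C) (L := spanned U).
have -> : F :|: spanned Y :|: C :|: spanned U = F :|: spanned U.
  rewrite -!setUA; congr (_ :|: _); rewrite setUA; apply/setUidPr.
  by rewrite subUset sCU spannedS.
apply=> E; rewrite inE => /andP[a b].
by apply: connect_link_mono (cUU _ _ a b); rewrite -setUA subsetUr.
Qed.

End OneEar.

(** Odd ears cost half a unit for each vertex that they absorb. *)
Lemma ear_growth Y0 Z : Y0 \subset Z -> closed_under Y0 -> connected_set Y0 ->
  (forall Y, Y0 \subset Y -> Y \proper Z -> closed_under Y -> connected_set Y ->
     exists u q, alternating_ear Y u q /\ ear_hull Y u q \subset Z) ->
  connected_set Z /\
  forall F, (g (F :|: spanned Y0)).*2 + #|Y0| <= (g (F :|: spanned Z)).*2 + #|Z|.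
Proof.
move=> + + + grow.
have : Y0 \subset Y0 by [].
move: {-1}Y0.
move=> Y; move Dn: (#|Z| - #|Y|) => n.
elim/ltn_ind: n Y Dn => n IH Y Dn Y0Y YZ mY cY.
have [e|ne] := eqVneq Y Z; first by rewrite -e; split.
have pYZ : Y \proper Z by rewrite properEneq ne.
have [u [q [ear sub]]] := grow Y Y0Y pYZ mY cY.
have [cU gU] := ear_step mY ear cY.
have YU : Y \subset ear_hull Y u q := ear_hull_mono Y u (leq0n q).
have cardU := card_ear_hull mY ear.
have q0 : 0 < q by case: ear.
have leU := subset_leq_card sub.
have [] := IH _ _ (ear_hull Y u q) erefl => //.
- by rewrite -Dn; move: (proper_card pYZ) leU; lia.
- exact: subset_trans Y0Y YU.
- exact: closed_ear_hull.
move=> cZ gZ; split=> // F; have := gZ F; have := gU F; rewrite cardU; lia.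
Qed.

End Ears.

(** * Matchings: the lemma of Gallai and an Edmonds barrier *)

Section Matchings.
Variables (W : finType) (e : rel W).
Hypothesis e_sym : symmetric e.
Implicit Types (S A : {set W}) (m n : {ffun W -> W}).

(** A matching is an involution that moves vertices along edges; its fixed
    points are the unmatched vertices. *)
Definition matching S m : bool :=
  [forall x, (m (m x) == x) && ((m x != x) ==> (x \in S) && e x (m x))].
Definition unmatched S m : {set W} := [set x in S | m x == x].
Definition maximum_matching S m : bool :=
  matching S m &&
  [forall n, matching S n ==> (#|unmatched S m| <= #|unmatched S n|)].
Definition deficiency S : nat :=
  #|unmatched S [arg min_(m < finfun id | matching S m) #|unmatched S m|]|.

Lemma matchingP S m :
  reflect (involutive m /\ forall x, m x != x -> x \in S /\ e x (m x))
          (matching S m).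
Proof.
apply: (iffP forallP) => [h|[mK h] x].
  split=> x; first by have /andP[/eqP] := h x.
  by have /andP[_ /implyP] := h x => /[apply] /andP[].
by rewrite mK eqxx /=; apply/implyP => /h[-> ->].
Qed.

Lemma matching_id S : matching S (finfun id).
Proof. by apply/matchingP; split=> x; rewrite !ffunE ?eqxx. Qed.

Lemma deficiencyP S :
  (exists2 m, matching S m & #|unmatched S m| = deficiency S) /\
  (forall m, matching S m -> deficiency S <= #|unmatched S m|).
Proof.
rewrite /deficiency; case: arg_minnP => [|m Sm h]; first exact: matching_id.
by split=> //; exists m.
Qed.

Lemma maximumP S m :
  reflect (matching S m /\ #|unmatched S m| = deficiency S)
          (maximum_matching S m).
Proof.
apply: (iffP andP) => [[Sm /forallP hm]|[Sm em]]; have [[n Sn en] h] := deficiencyP S.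
  move: (hm n); rewrite Sn /= en => le; split=> //.
  by apply/eqP; rewrite eqn_leq le h.
by split=> //; apply/forallP => n'; apply/implyP => /h; rewrite em.
Qed.

Lemma matching_in S m x : matching S m -> x \in S -> m x \in S.
Proof.
case/matchingP => mK h xS; have [->//|ne] := eqVneq (m x) x.
by apply: (h (m x) _).1; rewrite mK eq_sym.
Qed.

Lemma odd_unmatched S m : matching S m -> odd #|unmatched S m| = odd #|S|.
Proof.
case/matchingP => mK h.
pose lo := [set x | enum_rank x < enum_rank (m x)].
have loS : S :\: unmatched S m = lo :|: (m @: lo).
  apply/setP => x; rewrite !inE; apply/idP/idP => [/andP[+ xS]|].
    rewrite xS /= => ne.
    case: (ltnP (enum_rank x) (enum_rank (m x))) => [//|].
    rewrite leq_eqVlt => /orP[/eqP/val_inj/enum_rank_inj e1|lt].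
      by rewrite e1 eqxx in ne.
    by rewrite orbC /= -{1}[x]mK imset_f // inE mK.
  have lt_ne y : y \in lo -> m y != y.
    by rewrite inE; apply: contraTneq => ->; rewrite ltnn.
  case/orP => [lx|/imsetP[y /lt_ne ny ->]].
    have /lt_ne nx : x \in lo by rewrite inE.
    by rewrite (h x nx).1 nx.
  rewrite mK eq_sym (negPf ny) andbF /=.
  by apply: (h (m y) _).1; rewrite mK eq_sym.
have dis : [disjoint lo & m @: lo].
  rewrite -setI_eq0; apply/eqP/setP => x; rewrite !inE; apply/negP.
  by case/andP => lt /imsetP[y]; rewrite inE => lt2 e1; move: lt; rewrite e1 mK; lia.
have := cardsID (unmatched S m) S.
rewrite loS cardsU (disjoint_setI0 dis) cards0 subn0 card_imset; last exact: inv_inj.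
have -> : S :&: unmatched S m = unmatched S m.
  by apply/setIidPr/subsetP => x; rewrite inE => /andP[].
by move=> <-; rewrite addnn oddD odd_double addbF.
Qed.

Lemma maximum_no_edge S m x y : maximum_matching S m -> x \in S -> y \in S ->
  m x = x -> m y = y -> x != y -> ~~ e x y.
Proof.
case/maximumP => Sm dm xS yS mx my xy; apply/negP => exy.
have /matchingP[mK h] := Sm.
pose n := [ffun a => if a == x then y else if a == y then x else m a].
have nx : n x = y by rewrite ffunE eqxx.
have ny : n y = x by rewrite ffunE eqxx eq_sym (negPf xy).
have Sn : matching S n.
  apply/matchingP; split=> a.
    have [->|ax] := eqVneq a x; first by rewrite nx ny.
    have [->|ay] := eqVneq a y; first by rewrite ny nx.
    have -> : n a = m a by rewrite ffunE (negPf ax) (negPf ay).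
    rewrite ffunE; case: eqP => [e1|_].
      by case/eqP: ax; rewrite -[a]mK e1 mx.
    case: eqP => [e1|_]; last by rewrite mK.
    by case/eqP: ay; rewrite -[a]mK e1 my.
  have [->|ax] := eqVneq a x; first by rewrite nx.
  have [->|ay] := eqVneq a y; first by rewrite ny e_sym.
  by rewrite ffunE (negPf ax) (negPf ay); exact: h.
have := (deficiencyP S).2 _ Sn; rewrite -dm leqNgt => /negP; apply.
apply: proper_card; apply/properP; split; last first.
  by exists x; rewrite !inE ?xS ?mx ?nx //= eq_sym.
apply/subsetP => a; rewrite !inE => /andP[-> /=].
rewrite ffunE; have [->|ax] := eqVneq a x; first by rewrite eq_sym (negPf xy).
by have [->|//] := eqVneq a y; first by rewrite (negPf xy).
Qed.

(** Among the pairs of a maximum matching [m] that misses [u] and [v] and a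
    maximum matching [n] that misses [w], consider one that agrees on the most
    vertices. Both miss equally many vertices, so [n] misses some [x] other than
    [w] that [m] matches, say with [y]. Replacing the edge of [n] at [y] by
    [x y] gives a maximum matching that misses [w] and agrees more with [m]. *)
Lemma gallai_exchange S u w v : u \in S -> v \in S -> w \in S ->
  u != v -> w != u -> w != v ->
  (exists2 n, maximum_matching S n & n w = w) ->
  (forall m, maximum_matching S m -> m u = u -> m w = w -> False) ->
  (forall m, maximum_matching S m -> m w = w -> m v = v -> False) ->
  forall m, maximum_matching S m -> m u = u -> m v = v -> False.
Proof.
move=> uS vS wS uv wu wv [n0 max0 n0w] no_uw no_wv m0 maxm0 m0u m0v.
pose good (p : {ffun W -> W} * {ffun W -> W}) :=
  [&& maximum_matching S p.1, p.1 u == u, p.1 v == v,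
      maximum_matching S p.2 & p.2 w == w].
have good0 : good (m0, n0) by rewrite /good /= maxm0 max0 m0u m0v n0w !eqxx.
case: (arg_maxnP (fun p : {ffun W -> W} * {ffun W -> W} => #|[set x | p.1 x == p.2 x]|) good0).
case=> m n /=; rewrite {1}/good /= => /and5P[Mm /eqP mu /eqP mv Mn /eqP nw] best.
have [x [xS nx mx xw]] : exists x, [/\ x \in S, n x = x, m x != x & x != w].
  have [Sm dm] := maximumP _ _ Mm; have [Sn dn] := maximumP _ _ Mn.
  have eqc : #|unmatched S m :\: unmatched S n| =
             #|unmatched S n :\: unmatched S m|.
    apply: (@addnI #|unmatched S m :&: unmatched S n|).
    by rewrite cardsID setIC cardsID dm dn.
  have two : 1 < #|unmatched S m :\: unmatched S n|.
    have <- : #|[set u; v]| = 2 by rewrite cards2 uv.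
    apply/subset_leq_card/subsetP => a.
    case/set2P => ->; rewrite !inE ?uS ?vS ?mu ?mv eqxx !andbT /=; apply/eqP.
      by move=> nu; exact: no_uw Mn nu nw.
    by move=> nv; exact: no_wv Mn nw nv.
  move: two; rewrite eqc (cardsD1 w) => two.
  have : 0 < #|(unmatched S n :\: unmatched S m) :\ w|.
    by move: two; case: (w \in _); rewrite ?add1n ?add0n // => /ltnW.
  case/card_gt0P => x; rewrite !inE => /and3P[xw + /andP[xS /eqP nx]].
  by rewrite xS => mx; exists x.
have [Sm dm] := maximumP _ _ Mm; have [Sn dn] := maximumP _ _ Mn.
have /matchingP[mK hm] := Sm; have /matchingP[nK hn] := Sn.
have [_ exy] := hm _ mx.
set y := m x in exy mx.
have yS : y \in S := matching_in Sm xS.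
have ny : n y != y.
  apply/eqP => ny; move: exy; apply/negP.
  by apply: maximum_no_edge Mn _ _ _ _ _; rewrite // eq_sym.
set z := n y in ny.
have zx : z != x.
  by apply/eqP => e1; move: mx; rewrite -[y]nK -/z e1 nx eqxx.
have nz : n z = y by rewrite /z nK.
have wy : w != y by apply/eqP => e1; move: ny; rewrite /z -e1 nw eqxx.
pose n' := [ffun a => if a == x then y else if a == y then x
                      else if a == z then z else n a].
have n'x : n' x = y by rewrite ffunE eqxx.
have n'y : n' y = x by rewrite ffunE (negPf mx) eqxx.
have n'z : n' z = z by rewrite ffunE (negPf zx) (negPf ny) eqxx.
have n'E a : a != x -> a != y -> a != z -> n' a = n a.
  by rewrite ffunE => /negPf-> /negPf-> /negPf->.
have Sn' : matching S n'.
  apply/matchingP; split=> a.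
    have [->|ax] := eqVneq a x; first by rewrite n'x n'y.
    have [->|ay] := eqVneq a y; first by rewrite n'y n'x.
    have [->|az] := eqVneq a z; first by rewrite n'z n'z.
    rewrite (n'E a) // n'E ?nK //.
    - by apply: contra_neq ax => e1; rewrite -[a]nK e1 nx.
    - by apply: contra_neq az => e1; rewrite -[a]nK e1.
    - by apply: contra_neq ay => e1; rewrite -[a]nK e1 nz.
  have [->|ax] := eqVneq a x; first by rewrite n'x.
  have [->|ay] := eqVneq a y; first by rewrite n'y e_sym.
  have [->|az] := eqVneq a z; first by rewrite n'z eqxx.
  by rewrite n'E //; exact: hn.
have Mn' : maximum_matching S n'.
  apply/maximumP; split=> //; apply/eqP.
  rewrite eqn_leq (deficiencyP S).2 // andbT -dn.
  have xU : x \in unmatched S n by rewrite inE xS nx eqxx.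
  rewrite (cardsD1 x (unmatched S n)) xU /=.
  have sub : unmatched S n' \subset z |: (unmatched S n :\ x).
    apply/subsetP => a; rewrite !inE => /andP[-> /=].
    have [->|ax] := eqVneq a x; first by rewrite n'x (negPf mx).
    have [->|ay] := eqVneq a y; first by rewrite n'y eq_sym (negPf mx).
    by have [//|az] := eqVneq a z; rewrite n'E.
  by apply: leq_trans (subset_leq_card sub) _; rewrite cardsU1 leq_add2r leq_b1.
have good' : good (m, n').
  rewrite /good /= Mm mu mv Mn' !eqxx /=.
  have [->|wz] := eqVneq w z; first by rewrite n'z.
  by rewrite n'E ?nw // eq_sym.
have := best _ good'; rewrite leqNgt => /negP; apply => /=.
apply: proper_card; apply/properP; split; last first.
  by exists x; rewrite !inE ?n'x ?nx // eq_sym /y eq_sym.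
apply/subsetP => a; rewrite !inE => /eqP e1.
have [->|ax] := eqVneq a x; first by rewrite n'x.
have [->|ay] := eqVneq a y; first by rewrite n'y /y mK.
have [e2|az] := eqVneq a z; last by rewrite n'E // e1.
have : m z = m x by rewrite -e2 e1 e2 nz.
by move/(inv_inj mK)/eqP; rewrite (negPf zx).
Qed.

Definition restrict_rel S : rel W := fun x y => [&& x \in S, y \in S & e x y].

(** No maximum matching misses both ends of an edge, and by [gallai_exchange]
    this property of pairs is transitive, so it spreads along paths. *)
Lemma gallai S :
  {in S, forall v, exists2 n, maximum_matching S n & n v = v} ->
  forall m x y, maximum_matching S m -> x \in S -> connect (restrict_rel S) x y ->
  m x = x -> m y = y -> x = y.
Proof.
move=> miss m x y Mm xS /connectP[p pth ->].
elim: p x xS m Mm pth => [//|z p IH] x xS m Mm /= /andP[/and3P[_ zS exz] pth] mx my.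
have lS a q : a \in S -> path (restrict_rel S) a q -> last a q \in S.
  by elim: q a => [//|b q IHq] a _ /= /andP[/and3P[_ bS _]]; exact: IHq.
have vS := lS _ _ zS pth.
have [xz|xz] := eqVneq x z.
    subst z. exact (IH _ xS _ Mm pth mx my).
apply/eqP/negPn/negP => xv.
have [zv|zv] := eqVneq z (last z p).
  have := maximum_no_edge Mm xS vS mx my xv.
  by rewrite -zv exz.
apply: (@gallai_exchange S x z (last z p)) Mm mx my => //.
- by rewrite eq_sym.
- exact: miss.
- move=> n Mn nx nz; have := maximum_no_edge Mn xS zS nx nz xz.
  by rewrite exz.
- by move=> n Mn nz nv; move/eqP: zv; apply; exact: IH _ zS _ Mn pth nz nv.
Qed.

Definition restrict_matching S m : {ffun W -> W} :=
  [ffun x => if (x \in S) && (m x \in S) then m x else x].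

Lemma restrict_matchingP S T m : matching T m -> matching S (restrict_matching S m).
Proof.
case/matchingP => mK h; apply/matchingP; split=> x.
  rewrite ffunE [in X in (X \in S) && _]ffunE.
  rewrite !ffunE; case: (boolP ((x \in S) && (m x \in S))) => [/andP[xS mxS]|no].
    by rewrite mK mxS xS.
  by rewrite (negPf no).
rewrite ffunE; case: ifP => [/andP[xS _] /h[]|_] //; by rewrite eqxx.
Qed.

(** Take [A] as large as possible such that its removal raises the deficiency by
    its cardinality. By parity and maximality, each vertex that remains is
    missed by some maximum matching of the rest. Counting the vertices missed by
    the restriction of a maximum matching [M] shows that [M] uses all of [A] to
    cover vertices that the restriction misses. *)
Lemma gallai_edmonds : exists A M,
  [/\ matching setT M, {in A, forall a, M a \notin A},
      maximum_matching (~: A) (restrict_matching (~: A) M) &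
      {in ~: A, forall v, exists2 n, maximum_matching (~: A) n & n v = v}].
Proof.
(* The reverse inequality always holds. *)
pose extreme A := deficiency setT + #|A| <= deficiency (~: A).
have ext0 : extreme set0 by rewrite /extreme cards0 setC0 addn0.
case: (arg_maxnP (fun A : {set W} => #|A|) ext0) => A extA best.
have [[M SM dM] _] := deficiencyP setT.
exists A, M.
have [MK hM] := matchingP _ _ SM.
have SR := restrict_matchingP (~: A) SM.
set R := restrict_matching _ _ in SR.
pose B := [set a in A | M a \notin A].
have subR : unmatched (~: A) R \subset (unmatched setT M :\: A) :|: (M @: B).
  apply/subsetP => x; rewrite !inE ffunE !inE => /andP[xA /=]; rewrite xA /=.
  have [MA _|_ ->//] := boolP (M x \in A); apply/orP; right.
  by rewrite -[x]MK imset_f // inE MA MK.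
have cB : #|B| <= #|A| by apply/subset_leq_card/subsetP => a; rewrite inE => /andP[].
have cM : #|M @: B| = #|B| by rewrite card_imset //; exact: inv_inj.
have cR := subset_leq_card subR.
have cU : #|unmatched setT M :\: A :|: M @: B| <=
    #|unmatched setT M :\: A| + #|M @: B| by exact: leq_card_setU.
have cD := subset_leq_card (subsetDl (unmatched setT M) A).
have low := (deficiencyP (~: A)).2 _ SR.
have [eqB eqR] : #|B| = #|A| /\ #|unmatched (~: A) R| = deficiency (~: A).
  rewrite /extreme in extA; rewrite cM in cU; rewrite dM in cD.
  clear - cB cR cU cD low extA; lia.
split=> //.
- move=> a aA; have : a \in B; last by rewrite inE => /andP[].
  suff -> : B = A by [].
  apply/eqP; rewrite eqEcard eqB leqnn andbT.
  by apply/subsetP => b; rewrite inE => /andP[].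
- by apply/maximumP; split.
move=> v vA; have vA' : v \notin A by rewrite inE in vA.
have [[m Sm dm] _] := deficiencyP (~: A :\ v).
have mv : m v = v.
  by apply/eqP/negPn/negP => /(proj2 (matchingP _ _ Sm))[]; rewrite !inE eqxx.
have Sm' : matching (~: A) m.
  apply/matchingP; split; first by case/matchingP: Sm.
  by move=> x /(proj2 (matchingP _ _ Sm))[/setD1P[_]].
exists m => //; apply/maximumP; split=> //.
have eU : #|unmatched (~: A) m| = (deficiency (~: A :\ v)).+1.
  rewrite (cardsD1 v) !inE vA' mv eqxx /= add1n; congr _.+1; rewrite -dm.
  by apply: eq_card => x; rewrite !inE andbA.
have notext : ~~ extreme (v |: A).
  by apply/negP => /best; rewrite /= cardsU1 vA' /= add1n ltnn.
have eC : ~: (v |: A) = ~: A :\ v by rewrite setCU setIC setDE.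
move: notext; rewrite /extreme eC cardsU1 vA' /= -ltnNge => lt.
have ge := (deficiencyP (~: A)).2 _ Sm'.
have [[m1 Sm1 dm1] _] := deficiencyP (~: A).
have := odd_unmatched Sm'; rewrite -(odd_unmatched Sm1) dm1 eU.
rewrite /extreme in extA; rewrite eU in ge; clear - lt ge extA; lia.
Qed.

End Matchings.

(** * Components of the graph left by the barrier *)

(** As [b] fixes [x], applying [a] reverses the orbit of [x] under [b \o a]:
    [a (u j)] is the point that comes [j + 1] steps before [x]. If the orbit
    avoided [Y] it would close up, and halfway there would be a fixed point of
    [a] or a second fixed point of [b]. For the first [q] with [u q] in [Y],
    coincidences between earlier points are excluded in the same way. *)
Lemma alternating_path (T : finType) (a b : T -> T) (D Y : {set T}) (x : T) :
  involutive a -> involutive b -> {in D, forall z, a z \in D} ->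
  {in D, forall z, b z \in D} -> {in Y, forall z, a z \in Y} ->
  x \in D -> x \notin Y -> b x = x ->
  {in D, forall z, z \notin Y -> a z <> z} ->
  {in D, forall z, z \notin Y -> b z = z -> z = x} ->
  let u i := iter i (b \o a) x in
  (forall i, u i \in D) /\
  exists q, [/\ 0 < q, u q \in Y & forall i, i < q -> u i \notin Y /\
    forall j, j < q -> (u i = u j -> i = j) /\ u i <> a (u j)].
Proof.
move=> aK bK aD bD aY xD xY bx afix bfix u.
have f_inj : injective (b \o a) := inj_comp (inv_inj bK) (inv_inj aK).
have uD i : u i \in D by elim: i => [//|i IH]; rewrite /u iterS /= bD ?aD.
split=> //.
have uadd i j : u (i + j) = iter i (b \o a) (u j) by rewrite /u iterD.
have iter_inj i : injective (iter i (b \o a)).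
  by elim: i => [|i IH] // y z /= /f_inj/IH.
have uS i : u i.+1 = b (a (u i)) by [].
have back j : iter j.+1 (b \o a) (a (u j)) = x.
  elim: j => [|j IH]; first by rewrite /u /= aK bx.
  rewrite iterSr; have -> // : (b \o a) (a (u j.+1)) = a (u j).
  by rewrite /comp aK uS bK.
have exq : exists q, u q \in Y.
  (* Otherwise the middle of a period would be fixed by [a] or by [b]. *)
  have exP : exists P, (0 < P) && (u P == x).
    by exists (order (b \o a) x); rewrite order_gt0 /u iter_order ?eqxx.
  case: (ex_minnP exP) => P /andP[P0 /eqP uP] minP.
  case: (boolP [exists i : 'I_P, u i \in Y]) => [/existsP[i iY]|/existsPn no].
    by exists i.
  have {}no i : i < P -> u i \notin Y by move=> iP; exact: (no (Ordinal iP)).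
  exfalso; have eP := odd_double_half P; set c := P./2 in eP.
  case: (boolP (odd P)) => oP; rewrite ?oP ?(negPf oP) in eP.
    have cP : c < P by rewrite -eP; lia.
    apply: (afix _ (uD c) (no _ cP)); apply: (iter_inj c.+1).
    rewrite back -uadd -{1}uP -eP; congr (u _); lia.
  have c0 : 0 < c by move: P0; rewrite -eP; lia.
  have cP : c < P by rewrite -eP; lia.
  have e1 : a (u c.-1) = u c.
    apply: (iter_inj c); rewrite -{1}(prednK c0) back -uadd -{1}uP -eP.
    by congr (u _); lia.
  have e2 : b (u c) = u c by rewrite -{1}e1 -uS prednK.
  have := minP c; rewrite c0 (bfix _ (uD c) (no _ cP) e2) eqxx => /(_ isT).
  by rewrite leqNgt cP.
case: (ex_minnP exq) => q uqY minq.
have out i : i < q -> u i \notin Y.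
  by move=> iq; apply/negP => /minq; rewrite leqNgt iq.
have q0 : 0 < q by rewrite lt0n; apply: contraNneq xY => q0; rewrite q0 in uqY.
have noper P : 0 < P -> u P = x -> P <= q -> False.
  move=> P0 uP Pq; have /out/negP : q - P < q by lia.
  apply; suff -> : u (q - P) = u q by [].
  have -> : u q = u (q - P + P) by congr (u _); lia.
  by rewrite uadd uP.
exists q; split=> // i iq; split; first exact: out.
have inj i' j : i' < j -> j < q -> u i' <> u j.
  move=> ij jq e1; apply: (@noper (j - i')); [lia| |lia].
  apply: (iter_inj i'); rewrite -uadd -/(u i') e1; congr (u _); lia.
move=> j jq; split=> [e1|e1].
  by case: (ltngtP i j) => // lt; [case: (inj _ _ lt jq) | case: (inj _ _ lt iq)].
have uP : u (j.+1 + i) = x by rewrite uadd e1 back.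
have [le|lt] := leqP (j.+1 + i) q; first exact: noper uP le.
(* The orbit would have a period between [q] and [2q]; reversing it puts [u q]
   at [a (u k)], which is outside [Y]. *)
pose k := j.+1 + i - q.+1.
have e2 : u q = a (u k).
  apply: (iter_inj k.+1); rewrite back -uadd -uP; congr (u _).
  rewrite /k; lia.
have /out/negP : k < q by rewrite /k; lia.
by apply; rewrite -[u k]aK -e2 aY.
Qed.

Lemma sum_card_disjoint (I T : finType) (B : {set I}) (X : I -> {set T}) (U : {set T}) :
  {in B, forall a, X a \subset U} ->
  {in B &, forall a b x, x \in X a -> x \in X b -> a = b} ->
  \sum_(a in B) #|X a| <= #|U|.
Proof.
move=> sub dis.
have -> : \sum_(a in B) #|X a| = \sum_(x in U) \sum_(a in B) (x \in X a).
  rewrite exchange_big /=; apply: eq_bigr => a aB.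
  rewrite -sum1_card big_mkcond /= [RHS]big_mkcond /=.
  apply: eq_bigr => x _; have := subsetP (sub a aB) x.
  by case: (x \in X a) => [/(_ isT)->|_] //; case: (x \in U).
rewrite -sum1_card; apply: leq_sum => x _.
case: (pickP [pred a in B | x \in X a]) => [a /= /andP[aB xa]|no].
  rewrite (bigD1 a) //= xa big1 // => b /andP[bB ne].
  case: (boolP (x \in X b)) => // xb.
  by rewrite (dis b a bB aB x xb xa) eqxx in ne.
rewrite big1 // => a aB; have := no a; by rewrite /= aB /= => ->.
Qed.

Lemma connect_leave (T : finType) (r : rel T) (Y : {set T}) a b :
  connect r a b -> a \in Y -> b \notin Y ->
  exists y x, [/\ y \in Y, x \notin Y, r y x & connect r a x].
Proof.
case/connectP => p + ->; elim: p a => [|z p IH] a /=; first by move=> _ ->.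
case/andP => az pth aY bY; have [zY|zY] := boolP (z \in Y).
  have [y [x [? ? ? cx]]] := IH z pth zY bY.
  by exists y, x; split=> //; apply: connect_trans cx; exact: connect1.
by exists a, z; split=> //; exact: connect1.
Qed.

Section Components.
Variables (Ed W : finType) (s t : Ed -> W).
Implicit Types (F C L Q : {set Ed}) (Y Z U A S D K : {set W}) (E : Ed).
Implicit Types (m : {ffun W -> W}).

Local Notation adj := (link s t [set: Ed]).
Local Notation spanned := (spanned_edges s t).
Local Notation connected_set := (connected_set s t).

Definition component S r : {set W} := [set y | connect (restrict_rel adj S) r y].

Lemma restrict_rel_sym S : symmetric (restrict_rel adj S).
Proof.
move=> x y; rewrite /restrict_rel adj_sym.
by case: (x \in S); case: (y \in S).
Qed.

Lemma connect_restrict_sym S : connect_sym (restrict_rel adj S).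
Proof. exact/sym_connect_sym/restrict_rel_sym. Qed.

Lemma component_id S r : r \in component S r.
Proof. by rewrite inE connect0. Qed.

Lemma component_sub S r : r \in S -> component S r \subset S.
Proof.
move=> rS; apply/subsetP => x; rewrite inE => /connectP[p + ->].
by elim: p r rS => [|z p IH] r rS //= /andP[/and3P[_ zS _]]; exact: IH.
Qed.

Lemma component_closed S r x y : r \in S -> x \in component S r -> y \in S ->
  adj x y -> y \in component S r.
Proof.
move=> rS xD yS xy; have xS := subsetP (component_sub rS) x xD.
move: xD; rewrite !inE => /connect_trans; apply; apply: connect1.
by rewrite /restrict_rel xS yS.
Qed.

Lemma matching_component S r m : r \in S -> matching adj S m ->
  {in component S r, forall x, m x \in component S r}.
Proof.
move=> rS Sm x xD; have xS := subsetP (component_sub rS) x xD.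
have [->//|ne] := eqVneq (m x) x.
have /matchingP[_ /(_ x ne)[_ ?]] := Sm.
by apply: component_closed xD _ _ => //; exact: matching_in Sm xS.
Qed.

Section OneComponent.
Variables (S : {set W}) (r : W).
Hypothesis rS : r \in S.
Hypothesis miss :
  {in S, forall v, exists2 n, maximum_matching adj S n & n v = v}.

Lemma missed_unique m x y : maximum_matching adj S m ->
  x \in component S r -> y \in component S r -> m x = x -> m y = y -> x = y.
Proof.
move=> Mm xD yD; apply: gallai Mm _ _ => //; first exact: adj_sym.
  exact: (subsetP (component_sub rS)).
move: xD yD; rewrite !inE connect_restrict_sym; exact: connect_trans.
Qed.

(** Let [m] be a maximum matching that misses [r]. Start with the set of [r], and
    let [x] be a vertex next to the set [Y] absorbed so far. Following in turn
    [m] and a maximum matching that misses [x], both perfect elsewhere in the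
    component, leads from [x] back to [Y] along an odd ear. *)
Lemma component_cost g : ear_cost s t g ->
  connected_set (component S r) /\
  forall F, (g F).*2.+1 <= (g (F :|: spanned (component S r))).*2
                           + #|component S r|.
Proof.
move=> gP; set D := component S r.
have [m Mm mr] := miss rS; have [Sm _] := maximumP _ _ _ Mm.
have [mK hm] := matchingP _ _ _ Sm.
have [||||cD gD] := @ear_growth _ _ _ _ _ gP m mK [set r] D.
- by rewrite sub1set component_id.
- by move=> y /set1P->; rewrite mr inE.
- exact: connected_set1.
- move=> Y rY YD mY _.
  have {}rY : r \in Y by rewrite -sub1set.
  have [z0 z0D z0Y] : exists2 z, z \in D & z \notin Y.
    by have /properP[_] := YD.
  have [y [x [yY xY yx cx]]] : exists y x, [/\ y \in Y, x \notin Y,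
      restrict_rel adj S y x & connect (restrict_rel adj S) r x].
    by apply: connect_leave rY z0Y; rewrite inE in z0D.
  have xD : x \in D by rewrite inE.
  have xS := subsetP (component_sub rS) x xD.
  have [b Mb bx] := miss xS; have [Sb _] := maximumP _ _ _ Mb.
  have [bK hb] := matchingP _ _ _ Sb.
  have mD := matching_component rS Sm; have bD := matching_component rS Sb.
  have [||uD [q [q0 uqY uq]]] :=
      alternating_path mK bK mD bD mY xD xY bx.
  - by move=> z zD zY mz; rewrite (missed_unique Mm zD (component_id _ _) mz mr) rY in zY.
  - by move=> z zD zY bz; exact: missed_unique Mb zD xD bz bx.
  exists (fun i => iter i (b \o m) x), q; split.
    split=> //; first by exists y => //; case/and3P: yx.
    move=> i iq; have [uY uj] := uq i iq; split=> //.
      apply: (hm _ _).2; apply/eqP => mu.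
      by rewrite (missed_unique Mm (uD i) (component_id _ _) mu mr) rY in uY.
    rewrite iterS /=; apply: (hb _ _).2; apply/eqP => bu.
    have e1 := missed_unique Mb (mD _ (uD i)) xD bu bx.
    by have [_] := (uq 0 q0).2 i iq; apply; rewrite /= e1.
  apply/subsetP => w /mem_ear_hull[|[j jq [->|->]]] //.
  - exact: (subsetP (proper_sub YD)).
  - exact: mD.
split=> // F; have := gD F; rewrite cards1.
have : g F <= g (F :|: spanned [set r]).
  apply: (ear_cost_loops gP) => E.
  by rewrite inE => /andP[/set1P-> /set1P->]; exact: connect0.
by rewrite -/D; lia.
Qed.

End OneComponent.

(** Symmetric in [x] and [y], so that both ends of an edge of a matching choose
    the same element of [Ed]. *)
Definition edge_between x y : option Ed := [pick E | joins s t E x y].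

Lemma edge_between_sym x y : edge_between x y = edge_between y x.
Proof. by apply: eq_pick => E /=; rewrite joins_sym. Qed.

Lemma edge_betweenP x y : adj x y ->
  exists2 E, edge_between x y = Some E & joins s t E x y.
Proof.
move=> /adjP[E j]; rewrite /edge_between; case: pickP => [E' j'|no]; first by exists E'.
by have := no E; rewrite j.
Qed.

Lemma edge_between_joins x y E : edge_between x y = Some E -> joins s t E x y.
Proof. by rewrite /edge_between; case: pickP => // E' j [<-]. Qed.

Definition matching_edges m (K : {set W}) : {set Ed} :=
  [set E | [exists x in K, edge_between x (m x) == Some E]].

Lemma matching_edgesP m K E :
  reflect (exists2 x, x \in K & edge_between x (m x) = Some E)
          (E \in matching_edges m K).
Proof.
rewrite inE; apply: (iffP existsP) => [[x /andP[xK /eqP]]|[x xK e]].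
  by exists x.
by exists x; rewrite xK e /=.
Qed.

Lemma card_matching_edges m K : {in K, forall x, adj x (m x)} ->
  #|K| <= (#|matching_edges m K|).*2.
Proof.
move=> mK; set J := matching_edges m K.
have sub : K \subset (s @: J) :|: (t @: J).
  apply/subsetP => x xK; have [E e j] := edge_betweenP (mK x xK).
  have EJ : E \in J by apply/matching_edgesP; exists x.
  by rewrite inE; case/orP: j => /andP[/eqP h1 /eqP h2]; rewrite -?h1 -?h2 imset_f ?orbT.
apply: leq_trans (subset_leq_card sub) _.
apply: leq_trans (leq_card_setU _ _).1 _.
by rewrite -addnn leq_add ?leq_imset_card.
Qed.

Definition touching D : {set Ed} := [set E | (s E \in D) || (t E \in D)].

Definition degree Q x : nat := \sum_(E in Q) ((s E == x) + (t E == x)).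

Lemma odd_sum_addb (I : finType) (P : pred I) (f : I -> nat) :
  odd (\sum_(i | P i) f i) = \big[addb/false]_(i | P i) odd (f i).
Proof. by apply: (big_morph odd oddD). Qed.

Lemma odd_degree Q x : odd (degree Q x) = boundary s t Q x.
Proof.
rewrite /degree odd_sum_addb; apply: eq_bigr => E _.
by rewrite /incident oddD !oddb.
Qed.

Lemma sum_degree Q D :
  \sum_(x in D) degree Q x = \sum_(E in Q) ((s E \in D) + (t E \in D)).
Proof.
have one w : \sum_(x in D) (w == x) = (w \in D).
  case: (boolP (w \in D)) => wD.
    rewrite (bigD1 w) //= eqxx big1 // => x /andP[_ ne].
    by rewrite eq_sym (negPf ne).
  by rewrite big1 // => x xD; case: eqP wD => // ->; rewrite xD.
rewrite /degree exchange_big /=; apply: eq_bigr => E _.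
by rewrite big_split /= !one.
Qed.

(** Each vertex on an edge of [Q] has degree at least two in [Q]. Adding up the
    degrees over [D], the edges of the matching inside [D] are counted from both
    ends. The only edge of the matching that may leave [D] is counted from one
    end, but as [Q] is even it then has another edge that leaves [D]. *)
Lemma even_matching_bound Q D K m : even_set s t Q -> involutive m ->
  K \subset D -> {in K, forall x, adj x (m x)} -> {in K, forall x, m x != x} ->
  {in K, forall x, m x \in D -> m x \in K} ->
  {in K &, forall x y, m x \notin D -> m y \notin D -> x = y} ->
  (#|matching_edges m K :&: Q|).*2 <= #|Q :&: touching D|.
Proof.
move=> evQ mI KD mA mne mK out.
pose P := [set x in K | [exists E in Q, edge_between x (m x) == Some E]].
pose P1 := [set x in P | m x \notin D].
have PK x : x \in P -> x \in K by rewrite inE => /andP[].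
have PE x : x \in P -> exists2 E, E \in Q & edge_between x (m x) = Some E.
  by rewrite inE => /andP[_ /existsP[E /andP[EQ /eqP e]]]; exists E.
have cP1 : #|P1| <= 1.
  apply/card_le1_eqP => x y; rewrite !inE -!andbA.
  by move=> /and3P[xK _ xo] /and3P[yK _ yo]; exact: out.
have deg_even x : ~~ odd (degree Q x) by rewrite odd_degree evQ.
pose d := \sum_(E in Q) ((s E \in D) (+) (t E \in D)).
have eqd : (#|Q :&: touching D|).*2 = \sum_(x in D) degree Q x + d.
  rewrite sum_degree -big_split /= -muln2 -sum1_card big_distrl /=.
  rewrite big_mkcond [RHS]big_mkcond /=; apply: eq_bigr => E _.
  by rewrite !inE; case: (E \in Q); case: (s E \in D); case: (t E \in D).
have d_even : ~~ odd d.
  rewrite -[odd d]/(false (+) odd d).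
  have : odd ((#|Q :&: touching D|).*2) = false by rewrite odd_double.
  rewrite eqd oddD odd_sum_addb big1 => [/= ->//|x _].
  by apply/negbTE.
have degP : (#|P|).*2 <= \sum_(x in D) degree Q x.
  have PD : P \subset D.
    by apply/subsetP => x /PK/(subsetP KD).
  rewrite (big_setID P) /= (setIidPr PD) -muln2 -sum1_card big_distrl /=.
  apply: leq_trans (leq_addr _ _); apply: leq_sum => x xP.
  have [E EQ e] := PE x xP.
  have : 0 < degree Q x.
    rewrite /degree (bigD1 E) //=.
    by case/orP: (edge_between_joins e) => /andP[/eqP -> /eqP ->]; rewrite eqxx; lia.
  by have := deg_even x; case: (degree Q x) => [|[|k]].
have dP1 : (#|P1|).*2 <= d.
  have [->|] := posnP #|P1|; first by [].
  move/card_gt0P => [x]; rewrite inE => /andP[xP xo].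
  have [E EQ e] := PE x xP; have xD := subsetP KD x (PK x xP).
  have : 0 < d.
    rewrite /d (bigD1 E) //=.
    by case/orP: (edge_between_joins e) => /andP[/eqP -> /eqP ->];
      rewrite xD (negPf xo).
  by move: cP1 d_even; case: (d) => [|[|k]] //; case: #|P1| => [|[|k']].
(* One end of each edge of the matching that belongs to [Q]. *)
pose lo := [set x in P | (m x \notin D) || (enum_rank x < enum_rank (m x))].
have cJ : #|matching_edges m K :&: Q| <= #|lo|.
  rewrite -(card_imset _ Some_inj).
  apply: leq_trans (leq_imset_card (fun x => edge_between x (m x)) _).
  apply/subset_leq_card/subsetP => _ /imsetP[E /setIP[/matching_edgesP[x xK e] EQ] ->].
  have inP y : y \in K -> edge_between y (m y) = Some E -> y \in P.
    by move=> yK ey; rewrite inE yK; apply/existsP; exists E; rewrite EQ ey /=.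
  have [lx|nlx] := boolP (x \in lo).
    by rewrite -e; exact: (imset_f (fun x => edge_between x (m x))).
  move: nlx; rewrite inE (inP x xK e) /= negb_or negbK -leqNgt => /andP[mxD].
  rewrite leq_eqVlt => /orP[/eqP/val_inj/enum_rank_inj e1|lt].
    by have := mne x xK; rewrite e1 eqxx.
  have mxK := mK x xK mxD.
  have e2 : edge_between (m x) (m (m x)) = Some E by rewrite mI edge_between_sym.
  rewrite -e2; apply: (imset_f (fun x => edge_between x (m x))).
  by rewrite inE inP //= mI lt orbT.
have clo : (#|lo|).*2 <= #|P| + #|P1|.
  have P1lo : P1 \subset lo.
    by apply/subsetP => x; rewrite !inE => /andP[-> ->].
  have dis : [disjoint lo & m @: (lo :\: P1)].
    rewrite -setI_eq0; apply/eqP/setP => y; rewrite !inE; apply/negP.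
    case/andP=> /andP[yP ylo] /imsetP[x]; rewrite !inE => /andP[x1 /andP[xP xlo]] e.
    have mxD : m x \in D by move: x1; rewrite xP /= negbK.
    have xD : x \in D by apply: (subsetP KD); case/andP: xP.
    move: xlo ylo; rewrite mxD /= e mI xD /= => l1 l2.
    by move: (ltn_trans l1 l2); rewrite ltnn.
  have sub : lo :|: m @: (lo :\: P1) \subset P.
    rewrite subUset; apply/andP; split.
      by apply/subsetP => x; rewrite inE => /andP[].
    apply/subsetP => _ /imsetP[x + ->]; rewrite !inE => /andP[x1 /andP[xP _]].
    have mxD : m x \in D by move: x1; rewrite xP /= negbK.
    case/andP: xP => xK /existsP[E /andP[EQ e]]; rewrite mK //=.
    by apply/existsP; exists E; rewrite EQ mI edge_between_sym.
  have := subset_leq_card sub.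
  rewrite cardsU (disjoint_setI0 dis) cards0 subn0 card_imset; last exact: inv_inj.
  rewrite cardsD (setIidPr P1lo).
  by have := subset_leq_card P1lo; clear; lia.
clear - eqd degP dP1 cJ clo; lia.
Qed.

End Components.

(** * Large joins *)

Section Contractible.
Variables (Ed W : finType) (s t : Ed -> W) (g : {set Ed} -> nat).
Hypothesis gP : ear_cost s t g.
Implicit Types (F C L Q J : {set Ed}) (Y Z U A S D K : {set W}) (E : Ed).
Implicit Types (m : {ffun W -> W}).

Local Notation adj := (link s t [set: Ed]).
Local Notation spanned := (spanned_edges s t).
Local Notation connected_set := (connected_set s t).
Local Notation matching_edges := (matching_edges s t).
Local Notation component := (component s t).

(** The last condition concerns the even sets of the whole graph: it ensures that
    [J] can be added to every join of the graph in which [Z] is contracted. *)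
Definition contractible Z J : Prop :=
  [/\ connected_set Z, J \subset spanned Z,
      (exists E, [/\ s E \in Z, t E \in Z & s E != t E]),
      g set0 <= g (spanned Z) + #|J| &
      forall Q, even_set s t Q -> (#|J :&: Q|).*2 <= #|Q :&: spanned Z|].

(** With an empty barrier, odd ears contract the component of [r] at half a unit
    for each vertex but one: this is the size of a near-perfect matching. *)
Lemma contractible_component r E :
  {in setT, forall v, exists2 n, maximum_matching adj setT n & n v = v} ->
  s E != t E -> s E = r -> exists Z J, contractible Z J.
Proof.
move=> miss nE rE; have rT : r \in [set: W] by rewrite inE.
have [cD gD] := component_cost rT miss gP.
set D := component setT r in cD gD.
have [m Mm mr] := miss r rT; have [Sm _] := maximumP _ _ _ Mm.
have [mK hm] := matchingP _ _ _ Sm.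
have mD := matching_component rT Sm.
have rD : r \in D := component_id _ _ _ _.
have closedD : forall [x y], x \in D -> adj x y -> y \in D.
  by move=> x y xD; apply: component_closed xD _; rewrite ?inE.
pose K := D :\ r.
have mne : {in K, forall x, m x != x}.
  move=> x /setD1P[xr xD]; apply: contra_neq xr => mx.
  exact: missed_unique miss _ _ _ Mm xD rD mx mr.
have mA : {in K, forall x, adj x (m x)} by move=> x xK; exact: (hm x (mne x xK)).2.
have KD : K \subset D by exact: subD1set.
exists D, (matching_edges m K); split=> //.
- apply/subsetP => F /matching_edgesP[x /(subsetP KD) xD /edge_between_joins j].
  by rewrite (joins_ends _ j) xD mD.
- exists E; split=> //; first by rewrite rE.
  by apply: (@closedD r) => //; apply/adjP; exists E; rewrite /joins rE !eqxx.
- have := gD set0; have := card_matching_edges mA.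
  rewrite set0U (cardsD1 r D) rD -/K; clear; lia.
move=> Q evQ.
have -> : spanned D = touching s t D.
  apply/setP => F; rewrite [LHS]inE [RHS]inE; apply/andP/orP => [[->]|]; first by left.
  have jF : adj (s F) (t F) by apply/adjP; exists F; rewrite /joins !eqxx.
  case=> h; split=> //; first exact: closedD h jF.
  by apply: closedD h _; rewrite adj_sym.
apply: even_matching_bound => //.
- move=> x /setD1P[xr xD] mxD; rewrite inE mxD andbT inE.
  by apply: contra_neq xr => e; rewrite -[x]mK e mr.
- by move=> x y /(subsetP KD)/mD -> .
Qed.

Section Barrier.
Variables (A : {set W}) (M : {ffun W -> W}).
Hypotheses (SM : matching adj setT M) (MA : {in A, forall a, M a \notin A}).
Local Notation S := (~: A).
Hypothesis MR : maximum_matching adj S (restrict_matching S M).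
Hypothesis miss :
  {in S, forall v, exists2 n, maximum_matching adj S n & n v = v}.

(** The component of the rest of the graph that [M] matches to [a]. *)
Definition blob a : {set W} := component S (M a).
Definition sees : rel W := fun a b => (b \in A) && [exists y in blob a, adj y b].

Let MK : involutive M. Proof. by case/matchingP: SM. Qed.
Let MS a : a \in A -> M a \in S. Proof. by rewrite inE => /MA. Qed.

Let Madj x : M x != x -> adj x (M x).
Proof. by have /matchingP[_ h] := SM; move/h => []. Qed.

Let RM a : a \in A -> restrict_matching S M (M a) = M a.
Proof. by move=> aA; rewrite ffunE MK !inE aA andbF. Qed.

Lemma blobS a : a \in A -> blob a \subset S.
Proof. by move=> aA; apply: component_sub; exact: MS. Qed.

Lemma blob_id a : M a \in blob a. Proof. exact: component_id. Qed.

Lemma blob_inj a b x : a \in A -> b \in A -> x \in blob a -> x \in blob b -> a = b.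
Proof.
move=> aA bA xa xb; apply: (inv_inj MK).
have := missed_unique (MS aA) miss MR (blob_id a) _ (RM aA) (RM bA).
apply; move: xa xb; rewrite !inE => h1.
by rewrite connect_restrict_sym; exact: connect_trans.
Qed.

Lemma blob_closed a x y : a \in A -> x \in blob a -> y \in S -> adj x y ->
  y \in blob a.
Proof. by move=> aA; exact: component_closed (MS aA). Qed.

Lemma blob_matched a x : a \in A -> x \in blob a ->
  x != M a -> [/\ M x != x, M x \in blob a & M x \notin A].
Proof.
move=> aA xD xM.
have Rx : restrict_matching S M x != x.
  apply: contra_neq xM => Rx.
  exact: missed_unique (MS aA) miss _ _ _ MR xD (blob_id a) Rx (RM aA).
move: Rx; rewrite ffunE; case: ifP => [/andP[xS MxS] ne|]; last by rewrite eqxx.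
split=> //; last by rewrite inE in MxS.
by apply: blob_closed xD MxS _ => //; exact: Madj.
Qed.

Section Closed.
Variables (A' : {set W}) (a0 : W).
Hypotheses (A'A : A' \subset A) (a0A' : a0 \in A').
Hypothesis A'closed : forall a b, a \in A' -> sees a b -> b \in A'.
Hypothesis A'conn : {in A' &, forall a b, connect sees a b}.

Let inA a : a \in A' -> a \in A. Proof. exact: (subsetP A'A). Qed.

Definition core : {set W} := A' :|: \bigcup_(a in A') blob a.
Let Z := core.

Let blobZ a : a \in A' -> blob a \subset Z.
Proof. by move=> aA'; apply: subsetU; rewrite (bigcup_sup a) ?orbT. Qed.

Let ZP x : x \in Z -> x \in A' \/ exists2 a, a \in A' & x \in blob a.
Proof. by case/setUP => [|/bigcupP[a aA' xa]]; [left | right; exists a]. Qed.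

Let MZ x : x \in Z -> M x \in Z /\ M x != x.
Proof.
case/ZP => [xA'|[a aA' xa]].
  split; first by apply: (subsetP (blobZ xA')); exact: blob_id.
  by apply/eqP => e; have := MA (inA xA'); rewrite e inA.
have [->|ne] := eqVneq x (M a).
  rewrite MK; split; first by rewrite !inE aA'.
  by apply/eqP => e; have := MA (inA aA'); rewrite -e inA.
have [h1 h2 _] := blob_matched (inA aA') xa ne.
by split=> //; exact: (subsetP (blobZ aA')).
Qed.

Let touchZ a : a \in A' -> touching s t (blob a) \subset spanned Z.
Proof.
move=> aA'; have key x y : x \in blob a -> adj x y -> y \in Z.
  move=> xa xy; have [yA|yS] := boolP (y \in A).
    rewrite inE (A'closed aA') //; apply/andP; split=> //.
    by apply/existsP; exists x; rewrite xa.
  apply: (subsetP (blobZ aA')); apply: blob_closed xa _ xy; first exact: inA.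
  by rewrite inE.
apply/subsetP => E; rewrite inE [E \in spanned Z]inE.
have jE : adj (s E) (t E) by apply/adjP; exists E; rewrite /joins !eqxx.
case/orP => h.
  by rewrite (key _ _ h jE) andbT; exact: (subsetP (blobZ aA')).
rewrite adj_sym in jE; rewrite (key _ _ h jE) /=; exact: (subsetP (blobZ aA')).
Qed.

Let cardZ : #|A'| + \sum_(a in A') #|blob a| <= #|Z|.
Proof.
have dis : A' :&: \bigcup_(a in A') blob a = set0.
  apply/setP => x; rewrite !inE; apply/negP => /andP[/inA xA /bigcupP[a /inA aA]].
  by move/(subsetP (blobS aA)); rewrite inE xA.
rewrite /Z /core cardsU dis cards0 subn0 leq_add2l.
apply: sum_card_disjoint => [a aA'|a b /inA aA /inA bA x].
  exact: (bigcup_sup a).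
exact: blob_inj.
Qed.

Let Jbound Q : even_set s t Q ->
  (#|matching_edges M Z :&: Q|).*2 <= #|Q :&: spanned Z|.
Proof.
move=> evQ.
have sub : matching_edges M Z :&: Q \subset
    \bigcup_(a in A') (matching_edges M (blob a) :&: Q).
  apply/subsetP => E /setIP[/matching_edgesP[x /ZP xZ e] EQ].
  have [a [aA' [y ya ey]]] : exists a, a \in A' /\ exists2 y, y \in blob a &
      edge_between s t y (M y) = Some E.
    case: xZ => [xA'|[a aA' xa]]; last by exists a; split=> //; exists x.
    exists x; split=> //; exists (M x); first exact: blob_id.
    by rewrite MK edge_between_sym.
  apply/bigcupP; exists a => //; rewrite inE EQ andbT.
  by apply/matching_edgesP; exists y.
have bnd a : a \in A' -> (#|matching_edges M (blob a) :&: Q|).*2 <=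
    #|Q :&: touching s t (blob a)|.
  move=> aA'; have aA := inA aA'.
  have ne x : x \in blob a -> M x != x.
    by move=> xa; apply: (MZ _).2; exact: (subsetP (blobZ aA')).
  apply: even_matching_bound => //.
  - by move=> x /ne; exact: Madj.
  - move=> x y xa ya xo yo.
    have [->|xn] := eqVneq x (M a); last first.
      by have [_ h _] := blob_matched aA xa xn; rewrite h in xo.
    have [->//|yn] := eqVneq y (M a).
    by have [_ h _] := blob_matched aA ya yn; rewrite h in yo.
apply: leq_trans (_ : (\sum_(a in A') #|matching_edges M (blob a) :&: Q|).*2 <= _).
  rewrite leq_double; apply: leq_trans (subset_leq_card sub) _.
  elim/big_rec2: _ => [|a n U aA' IH]; first by rewrite cards0.
  by apply: leq_trans (leq_card_setU _ _).1 _; rewrite leq_add2l.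
rewrite -mul2n big_distrr /=.
apply: leq_trans (_ : \sum_(a in A') #|Q :&: touching s t (blob a)| <= _).
  by apply: leq_sum => a /bnd; rewrite mul2n.
apply: sum_card_disjoint => [a aA'|a b aA' bA' E].
  by rewrite setIS ?touchZ.
have [aA bA] := (inA aA', inA bA').
case/setIP => _; rewrite inE => h1; case/setIP => _; rewrite inE => h2.
have jE : adj (s E) (t E) by apply/adjP; exists E; rewrite /joins !eqxx.
have jE' : adj (t E) (s E) by rewrite adj_sym.
case/orP: h1 => h1; case/orP: h2 => h2; try exact: blob_inj h1 h2.
  exact: blob_inj aA bA (blob_closed aA h1 (subsetP (blobS bA) _ h2) jE) h2.
exact: blob_inj aA bA (blob_closed aA h1 (subsetP (blobS bA) _ h2) jE') h2.
Qed.

Let F1 := \bigcup_(a in A') spanned (blob a).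

Let costF1 F (r : seq W) : {subset r <= A'} ->
  (g F).*2 + size r <= (g (F :|: \bigcup_(a <- r) spanned (blob a))).*2
                       + \sum_(a <- r) #|blob a|.
Proof.
elim: r F => [|a r IH] F sub; first by rewrite !big_nil setU0 addn0.
have aA' : a \in A' by apply: sub; rewrite mem_head.
rewrite !big_cons setUA /=.
have subr : {subset r <= A'} by move=> x xr; apply: sub; rewrite inE xr orbT.
have := IH (F :|: spanned (blob a)) subr.
have := (component_cost (MS (inA aA')) miss gP).2 F.
rewrite -/(blob a); clear; lia.
Qed.

(** Contracts the blobs, each one to the vertex that is matched with [A']. *)
Definition shrink x : W :=
  if [pick a in A' | x \in blob a] is Some a then M a else x.

Let shrink_blob a x : a \in A' -> x \in blob a -> shrink x = M a.
Proof.
move=> aA' xa; rewrite /shrink; case: pickP => [b /andP[bA' xb]|/(_ a)].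
  by rewrite (blob_inj (inA bA') (inA aA') xb xa).
by rewrite aA' xa.
Qed.

Let shrink_out x : (forall a, a \in A' -> x \notin blob a) -> shrink x = x.
Proof.
move=> no; rewrite /shrink; case: pickP => // a /andP[/no/negPf->].
by [].
Qed.

Let shrink_A x : x \in A -> shrink x = x.
Proof.
move=> xA; apply: shrink_out => a /inA aA; apply/negP => /(subsetP (blobS aA)).
by rewrite inE xA.
Qed.

Let shrinkP x : shrink x = x \/ exists a, [/\ a \in A', x \in blob a & shrink x = M a].
Proof.
case: (pickP [pred a in A' | x \in blob a]) => [a /andP[aA' xa]|no].
  by right; exists a; split=> //; exact: shrink_blob.
left; apply: shrink_out => a aA'; have := no a.
by rewrite /= aA' /= => ->.
Qed.

Let F1_connect x y : shrink x = shrink y -> connect (link s t F1) x y.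
Proof.
have cb a u v : a \in A' -> u \in blob a -> v \in blob a ->
    connect (link s t F1) u v.
  move=> aA' ua va; have [cD _] := component_cost (MS (inA aA')) miss gP.
  apply: connect_link_mono (cD u v ua va); exact: (bigcup_sup a).
case: (shrinkP x) => [->|[a [aA' xa ->]]]; case: (shrinkP y) => [->|[b [bA' yb ->]]].
- by move=> ->; exact: connect0.
- by move=> ->; apply: cb yb => //; exact: blob_id.
- by move=> <-; apply: cb xa _ => //; exact: blob_id.
move=> /(inv_inj MK) e; rewrite -e in yb; exact: cb xa yb.
Qed.

Let s' := shrink \o s.
Let t' := shrink \o t.
Let g' F := g (F :|: F1).
Let g'P : ear_cost s' t' g'. Proof. exact: ear_cost_contract gP F1_connect. Qed.
Let Z' := A' :|: M @: A'.
Local Notation adj' := (link s' t' [set: Ed]).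

Let adj_shrink x y : adj x y -> adj' (shrink x) (shrink y).
Proof.
case/adjP => E j; apply/adjP; exists E; move: j; rewrite /joins /s' /t' /=.
by case/orP => /andP[/eqP-> /eqP->]; rewrite !eqxx ?orbT.
Qed.

Let shrink_M a : a \in A' -> shrink (M a) = M a.
Proof. by move=> aA'; rewrite (shrink_blob aA') ?blob_id. Qed.

Let adj'M a : a \in A' -> adj' a (M a).
Proof.
move=> aA'; rewrite -{1}(shrink_A (inA aA')) -(shrink_M aA').
apply/adj_shrink/Madj; by apply: (MZ _).2; rewrite inE aA'.
Qed.

Let adj'sees a b : a \in A' -> sees a b -> adj' (M a) b.
Proof.
move=> aA' /andP[bA /existsP[y /andP[ya yb]]].
by have := adj_shrink yb; rewrite (shrink_blob aA' ya) shrink_A.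
Qed.

Let Z'E x : (shrink x \in Z') = (x \in Z).
Proof.
case: (shrinkP x) => [e|[a [aA' xa ->]]]; last first.
  by rewrite (subsetP (blobZ aA')) // !inE imset_f ?orbT.
rewrite e; apply/setUP/idP => [[xA'|/imsetP[a aA' ->]]|/ZP[xA'|[a aA' xa]]].
- by rewrite inE xA'.
- by apply: (subsetP (blobZ aA')); exact: blob_id.
- by left.
- by right; rewrite -e (shrink_blob aA' xa) imset_f.
Qed.

Let spannedZ' : spanned_edges s' t' Z' = spanned Z.
Proof. by apply/setP => E; rewrite [LHS]inE [RHS]inE /s' /t' /= !Z'E. Qed.

Let card_Z' : #|Z'| = (#|A'|).*2.
Proof.
rewrite /Z' cardsU.
have -> : A' :&: M @: A' = set0.
  apply/setP => x; rewrite !inE; apply/negP => /andP[/inA xA /imsetP[a /inA aA e]].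
  by have := MA aA; rewrite -e xA.
by rewrite cards0 subn0 card_imset ?addnn //; exact: inv_inj.
Qed.

Let Y0 := [set a0; M a0].

(** When the blobs are points, a path of the relation [sees] that returns to [Y]
    alternates between [A'] and blobs, as the matching [M] does: together with
    the step that leaves [Y] it is an odd ear. *)
Let grow_Z' Y : Y0 \subset Y -> Y \proper Z' -> closed_under M Y ->
  exists u q, alternating_ear s' t' M Y u q /\ ear_hull M Y u q \subset Z'.
Proof.
move=> Y0Y YZ' MY.
have a0Y : a0 \in Y by apply: (subsetP Y0Y); rewrite !inE eqxx.
have [a1 a1A' a1Y] : exists2 a, a \in A' & a \notin Y.
  have /properP[_ [z /setUP[zA'|/imsetP[a aA' ->]] zY]] := YZ'; first by exists z.
  by exists a => //; apply: contra zY => /MY.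
have reach p a : a \in A' -> path sees a p -> {subset p <= A'}.
  elim: p a => [//|z p IH] a aA' /= /andP[az pth] x.
  have zA' := A'closed aA' az.
  by rewrite inE => /orP[/eqP->//|]; exact: IH pth _.
have [b [c [/setIP[bY bA'] cYA bc cc]]] : exists b c, [/\ b \in Y :&: A',
    c \notin Y :&: A', sees b c & connect sees a0 c].
  by apply: connect_leave (A'conn a0A' a1A') _ _; rewrite inE ?a0Y // (negPf a1Y).
have cA' : c \in A'.
  case/connectP: cc => p pth ec; have := mem_last a0 p; rewrite -ec inE.
  by case/orP => [/eqP->//|]; exact: reach a0A' pth _.
have cY : c \notin Y by move: cYA; rewrite inE cA' andbT.
have /connectP[p0 pth0 e0] := A'conn cA' a0A'.
case/shortenP: pth0 e0 => p pth uniq_p _ e0.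
have pA' := reach p c cA' pth.
pose l := c :: p; pose u := nth a0 l; pose q := find (mem Y) l.
have hasY : has (mem Y) l.
  by apply/hasP; exists a0 => //; rewrite e0 mem_last.
have ql : q < size l by rewrite -has_find.
have uA' i : i < size l -> u i \in A'.
  move=> il; have : u i \in l by apply: mem_nth.
  by rewrite inE => /orP[/eqP->|/pA'].
have uY i : i < q -> u i \notin Y by move=> iq; rewrite /u; have := before_find a0 iq => /= ->.
have uqY : u q \in Y by exact: (nth_find a0 hasY).
have step i : i.+1 < size l -> sees (u i) (u i.+1).
  by move=> il; have /(pathP a0)/(_ i il) := pth.
exists u, q; split; last first.
  apply/subsetP => w /mem_ear_hull[/(subsetP (proper_sub YZ'))//|[j jq]].
  have jA' : u j \in A' by apply: uA'; exact: ltn_trans jq ql.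
  by case=> ->; rewrite !inE ?jA' // imset_f ?orbT.
split=> //.
- by rewrite lt0n; apply: contraNneq cY => q0; rewrite q0 in uqY.
- by exists (M b); [exact: MY | exact: adj'sees].
move=> i iq; have il := ltn_trans iq ql; split; first exact: uY.
- exact/adj'M/uA'.
- by apply: adj'sees; [exact: uA' | apply: step; exact: leq_ltn_trans iq ql].
move=> j jq; have jl := ltn_trans jq ql; split.
  by move/eqP; rewrite /u nth_uniq // => /eqP.
by move=> e; have := MA (inA (uA' j jl)); rewrite -e inA ?uA'.
Qed.

(** The cost: a blob costs half a unit for each of its vertices but one, the edge
    from [a0] to its blob costs 1, and odd ears absorb the other pairs at cost 1
    each. This amounts to half of [#|Z|], the size of the perfect matching of
    [Z] induced by [M]. *)
Lemma core_contractible : contractible Z (matching_edges M Z).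
Proof.
have a0Z' : a0 \in Z' by rewrite inE a0A'.
have Y0Z' : Y0 \subset Z'.
  by rewrite subUset !sub1set a0Z' inE imset_f ?orbT.
have MY0 : closed_under M Y0.
  by move=> y /set2P[->|->]; rewrite ?MK !inE eqxx ?orbT.
have [E0 jE0] := adjP _ _ _ _ (adj'M a0A').
have E0Y0 : E0 \in spanned_edges s' t' Y0.
  by rewrite (joins_ends _ jE0) !inE !eqxx orbT.
have c0 F : E0 \in F -> {in Y0 &, forall x y, connect (link s' t' F) x y}.
  move=> EF x y; have c := connect1 (linkI EF jE0).
  have c' : connect (link s' t' F) (M a0) a0 by rewrite connect_link_sym.
  by move=> /set2P[->|->] /set2P[->|->] //; exact: connect0.
have [cZ' gZ'] := ear_growth g'P MK Y0Z' MY0 (c0 _ E0Y0)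
  (fun Y h1 h2 h3 _ => grow_Z' h1 h2 h3).
have F1Z : F1 \subset spanned Z.
  by apply/bigcupsP => a aA'; apply: spannedS; exact: blobZ.
split.
- have lift p : forall x y, path (link s' t' (spanned Z)) (shrink x) p ->
      last (shrink x) p = shrink y -> connect (link s t (spanned Z)) x y.
    elim: p => [|z p IH] x y /=.
      by move=> _ /F1_connect; exact: connect_link_mono.
    case/andP => /existsP[E /andP[EZ j]] pth lst.
    have jE : connect (link s t (spanned Z)) (s E) (t E).
      by apply/connect1/(linkI EZ); rewrite /joins !eqxx.
    case/orP: j => /andP[/eqP e1 /eqP e2].
      rewrite -e2 in pth lst; apply: connect_trans (IH _ _ pth lst).
      apply: connect_trans jE; rewrite connect_link_sym.
      exact: connect_link_mono F1Z (F1_connect e1).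
    rewrite -e1 in pth lst; apply: connect_trans (IH _ _ pth lst).
    rewrite connect_link_sym; apply: connect_trans jE _.
    exact: connect_link_mono F1Z (F1_connect e2).
  move=> x y; rewrite -!Z'E => xZ yZ.
  have := cZ' _ _ xZ yZ; rewrite spannedZ' => /connectP[p pth e].
  exact: lift pth (esym e).
- apply/subsetP => E /matching_edgesP[x xZ /edge_between_joins j].
  by rewrite (joins_ends _ j) xZ (MZ xZ).1.
- have a0Z : a0 \in Z by rewrite inE a0A'.
  have [Ma0Z ne] := MZ a0Z; have [E j] := adjP _ _ _ _ (Madj ne).
  exists E; have := joins_ends Z j; rewrite a0Z Ma0Z inE => /andP[-> ->]; split=> //.
  by case/orP: j ne => /andP[/eqP-> /eqP->] //; rewrite eq_sym.
- have c1 : (g set0).*2 + #|A'| <= (g' set0).*2 + \sum_(a in A') #|blob a|.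
    have := @costF1 set0 (enum A'); rewrite !big_enum /= -cardE; apply.
    by move=> x; rewrite mem_enum.
  have c2 : g' set0 <= (g' (set0 :|: spanned_edges s' t' Y0)).+1.
    apply: leq_trans (g'P.1 set0 E0) _; rewrite ltnS.
    have -> : set0 :|: spanned_edges s' t' Y0 = (E0 |: set0) :|: spanned_edges s' t' Y0.
      by apply/setP => E; rewrite !in_setU in_set0 in_set1 orbF /=;
         case: eqP => // ->; rewrite E0Y0.
    apply: (ear_cost_loops g'P) => E; rewrite inE => /andP[h1 h2].
    by apply: c0 => //; rewrite setU11.
  have c3 := gZ' set0.
  have cY0 : #|Y0| = 2.
    by rewrite cards2; case: eqP => // e; have := MA (inA a0A'); rewrite -e inA.
  rewrite cY0 card_Z' spannedZ' in c3.
  have eg : g' (set0 :|: spanned Z) = g (spanned Z).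
    by rewrite /g' set0U (setUidPl F1Z).
  rewrite eg in c3.
  have c4 : #|Z| <= (#|matching_edges M Z|).*2.
    by apply: card_matching_edges => x xZ; apply: Madj; exact: (MZ xZ).2.
  have c5 := cardZ; clear - c1 c2 c3 c4 c5; lia.
- exact: Jbound.
Qed.

End Closed.
End Barrier.

(** A set closed under [sees] that is as small as possible is strongly connected
    for this relation. *)
Lemma exists_contractible E : s E != t E -> exists Z J, contractible Z J.
Proof.
move=> nE; have [A [M [SM MA MR miss]]] := gallai_edmonds (link s t setT).
case: (set_0Vmem A) => [A0|[a aA]].
  by rewrite A0 setC0 in miss; exact: contractible_component miss nE erefl.
pose r := sees A M.
pose reach b := [set c | connect r b c].
case: (@arg_minnP _ a (mem A) (fun b => #|reach b|) aA) => a0 a0A minr.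
have rA b c : b \in A -> connect r b c -> c \in A.
  move=> bA /connectP[p + ->]; elim: p b bA => [|z p IH] b bA //=.
  by case/andP => /andP[zA _]; exact: IH.
have back b : b \in reach a0 -> a0 \in reach b.
  rewrite inE => ab; have bA := rA _ _ a0A ab.
  have sub : reach b \subset reach a0.
    by apply/subsetP => c; rewrite !inE; exact: connect_trans.
  have /eqP-> : reach b == reach a0 by rewrite eqEcard sub; exact: minr.
  by rewrite inE connect0.
exists (core A M (reach a0)), (matching_edges M (core A M (reach a0))).
apply: (@core_contractible _ _ SM MA MR miss _ a0) => //.
- by apply/subsetP => b; rewrite inE; exact: rA.
- by rewrite inE connect0.
- by move=> b c; rewrite !inE => ab bc; apply: connect_trans ab (connect1 bc).
move=> b c bR cR; apply: (@connect_trans _ _ a0).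
  by have := back b bR; rewrite inE.
by rewrite inE in cR.
Qed.
End Contractible.

Theorem large_join (Ed W : finType) (s t : Ed -> W) (g : {set Ed} -> nat) :
  ear_cost s t g -> g setT = 0 ->
  exists2 J : {set Ed}, g set0 <= #|J| &
    forall Q, even_set s t Q -> (#|J :&: Q|).*2 <= #|Q|.
Proof.
move Dn: #|[set E | s E != t E]| => n.
elim/ltn_ind: n s t g Dn => n IH s t g Dn gP g1.
have [/existsP[E0 nE0]|/existsPn loops] := boolP [exists E, s E != t E]; last first.
  exists set0; last by move=> Q _; rewrite set0I cards0.
  rewrite cards0 -g1 -(set0U setT).
  apply: (ear_cost_loops gP) => E _; move: (loops E); rewrite negbK => /eqP->.
  exact: connect0.
have [Z [J [cZ JZ [E1 [sE1 tE1 nE1]] costJ Jbound]]] := exists_contractible gP nE0.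
pose k w := if w \in Z then s E1 else w.
have kF x y : k x = k y -> connect (link s t (spanned_edges s t Z)) x y.
  rewrite /k; case: (boolP (x \in Z)) => xZ; case: (boolP (y \in Z)) => yZ.
  - by move=> _; exact: cZ.
  - by move=> e; rewrite -e sE1 in yZ.
  - by move=> e; rewrite e sE1 in xZ.
  - by move=> ->; exact: connect0.
have [||J' cJ' J'bound] := IH _ _ _ _ _ erefl (ear_cost_contract gP kF).
- rewrite -Dn; apply: proper_card; apply/properP; split.
    by apply/subsetP => E; rewrite !inE; apply: contra_neq => /= ->.
  by exists E1; rewrite !inE ?nE1 //= /k sE1 tE1 eqxx.
- by rewrite setTU.
have loopZ E : E \in spanned_edges s t Z -> incident (k \o s) (k \o t) E =1 xpred0.
  by rewrite inE => /andP[h1 h2] w; rewrite /incident /= /k h1 h2 addbb.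
have dis : J' :&: spanned_edges s t Z = set0.
  apply/setP => E; rewrite inE in_set0; apply/negP => /andP[EJ' EZ].
  have ev : even_set (k \o s) (k \o t) [set E].
    by move=> w; rewrite boundary1 loopZ.
  have := J'bound _ ev; have /setIidPr -> : [set E] \subset J' by rewrite sub1set.
  by rewrite cards1.
have dis' : J' :&: J = set0.
  by apply/eqP; rewrite -subset0 -dis setIS.
exists (J' :|: J).
  rewrite cardsU dis' cards0 subn0; rewrite set0U in cJ'.
  by apply: leq_trans costJ _; rewrite leq_add2r.
move=> Q evQ.
have ev : even_set (k \o s) (k \o t) (Q :\: spanned_edges s t Z).
  move=> w; have : boundary (k \o s) (k \o t) Q w = false.
    by rewrite boundary_comp big1.
  rewrite /boundary (big_setID (spanned_edges s t Z)) /= [X in X (+) _]big1 //.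
  by move=> E /setIP[_ /loopZ].
have := J'bound _ ev; have := Jbound _ evQ.
have -> : J' :&: (Q :\: spanned_edges s t Z) = J' :&: Q.
  apply/setP => E; move/setP/(_ E): dis; rewrite in_set0 !in_setI in_setD.
  by case: (E \in J') => //= ->.
rewrite -(cardsID (spanned_edges s t Z) Q).
have : #|(J' :|: J) :&: Q| <= #|J' :&: Q| + #|J :&: Q|.
  by rewrite setIUl; exact: (leq_card_setU _ _).1.
clear; lia.
Qed.

(** * Feedback vertex sets, cuts and abstract duals *)

Section Forests.
Variables (V : finType) (e : rel V).
Hypotheses (e_sym : symmetric e) (e_irr : irreflexive e).
Implicit Types (A B S X : {set V}).

Lemma induces_forestS A B : A \subset B -> induces_forest e B -> induces_forest e A.
Proof. by move=> /subsetP AB fB c cA; apply: fB => x /cA/AB. Qed.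

Definition neighbours B x : {set V} := [set y in B | e x y].

(** Otherwise paths could be prolonged for ever: all neighbours of the first
    vertex being on the path, one of them that is not the second vertex closes a
    cycle. *)
Lemma forest_leaf A x : x \in A -> induces_forest e A ->
  exists2 v, v \in A & #|neighbours A v| <= 1.
Proof.
move=> xA fA.
case: (pickP [pred v in A | #|neighbours A v| <= 1]) => [v /andP[]|big].
  by exists v.
have {}big v : v \in A -> 1 < #|neighbours A v|.
  by move=> vA; have := big v; rewrite /= vA /= ltnNge => ->.
exfalso.
have long n : exists v p, [/\ path e v p, uniq (v :: p),
    {subset v :: p <= A} & size p = n].
  elim: n => [|n [v [p [pth up pA sp]]]].
    by exists x, [::]; split=> // y; rewrite inE => /eqP->.
  have vA : v \in A by apply: pA; rewrite mem_head.
  case: (pickP [pred y in neighbours A v | y \notin p]) => [y|no].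
    rewrite /= inE => /andP[/andP[yA vy] yp].
    exists y, (v :: p); split; rewrite /= ?sp //.
    - by rewrite e_sym vy.
    - rewrite inE negb_or yp !andbT; move: up => /= ->; rewrite andbT.
      by apply: contraTneq vy => ->; rewrite e_irr.
    - by move=> z; rewrite inE => /orP[/eqP->//|]; exact: pA.
  have Np y : y \in neighbours A v -> y \in p.
    by move=> yN; have := no y; rewrite /= yN => /negbFE.
  have [y yN yh] : exists2 y, y \in neighbours A v & y != head v p.
    have := big v vA; rewrite (cardsD1 (head v p)) => h.
    have : 0 < #|neighbours A v :\ head v p|.
      by move: h; case: (_ \in _); rewrite ?add1n ?add0n // => /ltnW.
    by case/card_gt0P => y /setD1P[]; exists y.
  have yp := Np y yN; exfalso.
  move: yN; rewrite inE => /andP[yA vy].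
  case/path.splitP: yp pth up pA yh {Np no sp} => p1 p2 pth up pA yh.
  have sub : {subset v :: rcons p1 y <= A}.
    by move=> z zp; apply: pA; rewrite -cat_cons mem_cat zp.
  apply: (fA (v :: rcons p1 y) sub).
    by case: p1 yh {pth up pA sub} => [|z p1] //=; rewrite ?eqxx // size_rcons.
  rewrite /ucycle; apply/andP; split.
    move: pth; rewrite cat_path => /andP[pth _].
    by rewrite /cycle rcons_path pth last_rcons e_sym vy.
  by move: up; rewrite -cat_cons cat_uniq => /andP[].
have [v [p [_ up _ sp]]] := long #|V|.
by have := max_card (mem (v :: p)); rewrite (card_uniqP up) /= sp ltnn.
Qed.

Lemma forest_add A v : induces_forest e A -> #|neighbours A v| <= 1 ->
  induces_forest e (v |: A).
Proof.
move=> fA leaf c cA sc uc.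
have [vc|vc] := boolP (v \in c); last first.
  apply: (fA c) => // x xc; have := cA x xc; rewrite !inE => /orP[/eqP e1|//].
  by rewrite -e1 xc in vc.
have [i c' ec] := rot_to vc.
have uc' : ucycle e (v :: c') by rewrite -ec rot_ucycle.
have cA' : {subset v :: c' <= v |: A} by move=> x; rewrite -ec mem_rot => /cA.
have sc' : 2 < size (v :: c') by rewrite -ec size_rot.
case: c' {ec} uc' cA' sc' => [|y c'] //.
case/lastP: c' => [|c' z] // /andP[cyc un] cA' _.
have inA x : x \in y :: rcons c' z -> x \in A.
  move=> xc; have := cA' x; rewrite inE xc orbT => /(_ isT).
  rewrite !inE => /orP[/eqP e1|//]; move: un => /=; rewrite -e1.
  by rewrite inE in xc; rewrite inE xc.
have zc : z \in y :: rcons c' z by rewrite inE mem_rcons mem_head orbT.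
have vy : e v y by move: cyc => /= /andP[].
have vz : e v z.
  move: cyc; rewrite /cycle rcons_path last_cons last_rcons => /andP[_].
  by rewrite e_sym.
move/card_le1_eqP: leaf => /(_ y z).
rewrite !inE vy vz !inA ?mem_head // => /(_ isT isT) yz.
move: un => /= /and3P[_ + _]; rewrite yz mem_rcons mem_head.
by [].
Qed.

Definition crossing A B : nat := \sum_(x in A) #|neighbours B x|.

(** Induction on [A], at a vertex [v] with at most one neighbour in [A]. If [v]
    has two or more in [B], its deletion removes as many crossing edges. If it
    has one, then [v] can be moved to [B]: its edge to [B] ceases to cross, and
    at most one edge to [A] becomes crossing. If it has none, then [v] has
    degree at most one in the union and lies on no cycle. *)
Lemma merge_forests A B : induces_forest e A -> induces_forest e B ->
  exists2 S : {set V}, (#|S|).*2 <= crossing A B & induces_forest e ((A :|: B) :\: S).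
Proof.
move Dn: #|A| => n; elim: n A B Dn => [|n IH] A B Dn fA fB.
  exists set0; first by rewrite cards0.
  by rewrite setD0 (cards0_eq Dn) set0U.
have [x xA] : exists x, x \in A by apply/card_gt0P; rewrite Dn.
have [v vA leaf] := forest_leaf xA fA.
have Dn' : #|A :\ v| = n by move: Dn; rewrite (cardsD1 v) vA => -[].
have fA' := induces_forestS (subsetDl A [set v]) fA.
have eqc : crossing A B = #|neighbours B v| + crossing (A :\ v) B.
  by rewrite /crossing (big_setD1 v).
have leafA' : #|neighbours (A :\ v) v| <= 1.
  apply: leq_trans (subset_leq_card _) leaf.
  by apply/subsetP => y; rewrite !inE => /andP[/andP[_ ->] ->].
have [two|] := leqP 2 #|neighbours B v|.
  have [S cS fS] := IH _ _ Dn' fA' fB; exists (v |: S).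
    rewrite eqc cardsU1; move: two cS; case: (v \notin S) => /=; clear; lia.
  apply: induces_forestS fS; apply/subsetP => y; rewrite !inE.
  by case: (y == v); case: (y \in S).
rewrite ltnS leq_eqVlt ltnS leqn0 => /orP[one|zero].
  have fB' : induces_forest e (v |: B) by apply: forest_add => //; rewrite (eqP one).
  have [S cS fS] := IH _ _ Dn' fA' fB'; exists S.
    apply: leq_trans cS _; rewrite eqc (eqP one) /crossing.
    apply: leq_trans (_ : #|neighbours (A :\ v) v| + crossing (A :\ v) B <= _);
      last by rewrite leq_add2r.
    have -> : #|neighbours (A :\ v) v| = \sum_(y in A :\ v) (e y v : nat).
      rewrite -sum1_card big_mkcond [RHS]big_mkcond; apply: eq_bigr => y _.
      by rewrite !inE [e y v]e_sym; case: (y == v); case: (y \in A); case: (e v y).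
    rewrite -big_split /=; apply: leq_sum => y _.
    have [yv|yv] := boolP (e y v); last first.
      apply/subset_leq_card/subsetP => z; rewrite !inE.
      by case: eqP => [->|//]; rewrite (negPf yv) andbF.
    apply: leq_trans (_ : #|v |: neighbours B y| <= _).
      apply/subset_leq_card/subsetP => z; rewrite !inE => /andP[/orP[->//|->] ->].
      by rewrite orbT.
    by rewrite cardsU1 leq_add2r leq_b1.
  by move: fS; rewrite setUA [_ :|: [set v]]setUC setD1K.
have [S cS fS] := IH _ _ Dn' fA' fB; exists S.
  by apply: leq_trans cS _; rewrite eqc leq_addl.
have sub : (A :|: B) :\: S \subset v |: (((A :\ v) :|: B) :\: S).
  by apply/subsetP => y; rewrite !inE; case: (y == v).
apply: induces_forestS sub _; apply: forest_add => //.
apply: leq_trans (subset_leq_card _) leafA'.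
apply/subsetP => y; rewrite !inE => /andP[/andP[_ /orP[-> //|yB]] vy].
have : y \in neighbours B v by rewrite inE yB.
by move: zero; rewrite cards_eq0 => /eqP->; rewrite inE.
Qed.

End Forests.

Section AbstractDual.
Variables (V : finType) (e : rel V).
Hypotheses (e_sym : symmetric e) (e_irr : irreflexive e).
Implicit Types (S X : {set V}) (F C J : {set {set V}}).

(** Every set of vertices is an edge of the dual; those that are not edges of the
    graph are loops. *)
Definition abstract_dual (W : finType) (s t : {set V} -> W) : Prop :=
  [/\ forall E, E \notin edges e -> s E = t E,
      forall X, even_set s t (edge_cut e X) &
      forall C, even_set s t C -> exists X, forall x y, e x y ->
        ([set x; y] \in C) = (x \in X) (+) (y \in X)].

Definition delete_edges F : rel V := fun x y => e x y && ([set x; y] \notin F).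

Lemma delete_edges_sym F : symmetric (delete_edges F).
Proof. by move=> x y; rewrite /delete_edges e_sym setUC. Qed.

Lemma delete_edges_irr F : irreflexive (delete_edges F).
Proof. by move=> x; rewrite /delete_edges e_irr. Qed.

Lemma induces_forest_sub (r r' : rel V) (A : {set V}) :
  {in A &, subrel r' r} -> induces_forest r A -> induces_forest r' A.
Proof.
move=> sub fA c cA sc /andP[cyc un]; apply: (fA c cA sc).
rewrite /ucycle un andbT; case: c cyc cA {sc un} => [//|x p] /= pth cA.
apply: sub_in_path pth; last first.
  apply/allP => y; rewrite inE mem_rcons inE => /orP[/eqP->|/orP[/eqP->|yp]].
  - exact/cA/mem_head.
  - exact/cA/mem_head.
  - by apply: cA; rewrite inE yp orbT.
by move=> y z yA zA; exact: sub.
Qed.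

Lemma fvs_remove_edge F E : fvs (delete_edges F) <= (fvs (delete_edges (E |: F))).+1.
Proof.
have [[S fS <-] _] := fvsP (delete_edges (E |: F)).
have [[_ _ _] least] := fvsP (delete_edges F).
have [E0|[x xE]] := set_0Vmem E.
  apply: leqW; apply: least; apply: induces_forest_sub fS => x y _ _.
  rewrite /delete_edges => /andP[-> /=]; rewrite in_setU1 negb_or => ->; rewrite andbT.
  by apply/eqP => /setP/(_ x); rewrite E0 !inE eqxx.
apply: leq_trans (least (x |: S) _) _; last by rewrite cardsU1; case: (_ \notin _).
have fS' : induces_forest (delete_edges (E |: F)) (~: (x |: S)).
  by apply: induces_forestS fS; rewrite setCS subsetUr.
apply: induces_forest_sub fS' => y z; rewrite !inE !negb_or => /andP[yx _] /andP[zx _].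
rewrite /delete_edges => /andP[-> /=] yzF; rewrite in_setU1 negb_or yzF andbT.
apply: contraTneq xE => <-.
by rewrite !inE negb_or ![x == _]eq_sym yx zx.
Qed.

(** Both sides of the cut minus a feedback vertex set are forests, to which
    [merge_forests] applies. *)
Lemma fvs_remove_cut F C X : 
  (forall x y, e x y -> ([set x; y] \in C) = (x \in X) (+) (y \in X)) ->
  fvs (delete_edges F) <= fvs (delete_edges (F :|: C)) + #|C :\: F|./2.
Proof.
move=> XC; have [[S fS <-] _] := fvsP (delete_edges (F :|: C)).
have [_ least] := fvsP (delete_edges F).
pose A := X :\: S; pose B := ~: X :\: S.
have side (Z : {set V}) : Z \subset ~: S -> {in Z &, forall x y, (x \in X) = (y \in X)} ->
    induces_forest (delete_edges F) Z.
  move=> ZS same; have := induces_forestS ZS fS.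
  apply: induces_forest_sub => x y xZ yZ; rewrite /delete_edges => /andP[exy].
  by rewrite in_setU negb_or exy XC // (same x y) // addbb => ->.
have fA : induces_forest (delete_edges F) A.
  apply: side => [|x y]; first by apply/subsetP => x; rewrite !inE => /andP[].
  by rewrite !inE => /andP[_ ->] /andP[_ ->].
have fB : induces_forest (delete_edges F) B.
  apply: side => [|x y]; first by apply/subsetP => x; rewrite !inE => /andP[].
  by rewrite !inE => /andP[_ /negPf->] /andP[_ /negPf->].
have [S' cS fS'] := merge_forests (delete_edges_sym F) (delete_edges_irr F) fA fB.
have crossCF : crossing (delete_edges F) A B <= #|C :\: F|.
  have -> : crossing (delete_edges F) A B =
      #|[set p | [&& p.1 \in A, p.2 \in B & delete_edges F p.1 p.2]]|.
    rewrite /crossing; under eq_bigr do rewrite -sum1_card.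
    rewrite pair_big_dep /= sum1dep_card; apply: eq_card => -[x y].
    by rewrite !inE.
  rewrite -(@card_in_imset _ _ (fun p => [set p.1; p.2])); last first.
    move=> [x y] [x' y']; rewrite !inE /=.
    move=> /and3P[/andP[_ xX] /andP[_ yX] _] /and3P[/andP[_ xX'] /andP[_ yX'] _].
    move/setP => h; have := h x; have := h y; rewrite !inE !eqxx orbT.
    case: eqP => [e1|_ /=]; first by rewrite e1 xX' in yX.
    move=> /esym/eqP->; case: eqP => [->//|_ /=] /esym/eqP e2.
    by rewrite e2 (negPf yX') in xX.
  apply/subset_leq_card/subsetP => _ /imsetP[[x y] + ->]; rewrite inE /=.
  case/and3P; rewrite !in_setD => /andP[_ xX] /andP[_ yX] /andP[exy ->].
  by rewrite XC // xX; rewrite inE in yX; rewrite (negPf yX).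
have fSS : feedback_vertex_set (delete_edges F) (S :|: S').
  apply: induces_forestS fS'; apply/subsetP => x; rewrite !inE negb_or.
  by case: (x \in X); case: (x \in S); case: (x \in S').
apply: leq_trans (least _ fSS) _.
apply: leq_trans (leq_card_setU _ _).1 _; rewrite leq_add2l.
clear - cS crossCF; lia.
Qed.

Lemma fvs_ear_cost (W : finType) (s t : {set V} -> W) : abstract_dual s t ->
  ear_cost s t (fun F => fvs (delete_edges F)).
Proof.
case=> _ _ cut; split=> [F E|F C /cut[X XC]]; first exact: fvs_remove_edge.
exact: fvs_remove_cut XC.
Qed.

Lemma fvs_no_edge : fvs (delete_edges setT) = 0.
Proof.
have [_ least] := fvsP (delete_edges setT).
apply/eqP; rewrite -leqn0 -(cards0 V); apply: least => c _.
case: c => [|x [|y c]] //= _ /andP[+ _].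
by rewrite /= /delete_edges inE andbF.
Qed.

Lemma card_symdiff (T : finType) (A B : {set T}) :
  #|symdiff A B| = #|A :\: B| + #|B :\: A|.
Proof.
rewrite /symdiff cardsU; have -> : (A :\: B) :&: (B :\: A) = set0.
  by apply/setP => x; rewrite !inE; case: (x \in A); case: (x \in B).
by rewrite cards0 subn0.
Qed.

(** Switching a join [J] by a cut [C] replaces at most half of [C] by the other
    half, so it never produces fewer negative edges. *)
Lemma fvs_le_frustration (W : finType) (s t : {set V} -> W) :
  abstract_dual s t -> fvs e <= max_frustration_index e.
Proof.
move=> dual; have [loops cuts _] := dual.
have [J gJ Jb] := large_join (fvs_ear_cost dual) fvs_no_edge.
have JE : J \subset edges e.
  apply/subsetP => E EJ; apply/negPn/negP => /loops sE.
  have ev : even_set s t [set E] by move=> w; rewrite boundary1 /incident sE addbb.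
  have := Jb _ ev; have /setIidPr -> : [set E] \subset J by rewrite sub1set.
  by rewrite cards1.
have fvsJ : fvs e <= #|J|.
  apply: leq_trans gJ; have [_ least] := fvsP e.
  have [[S fS <-] _] := fvsP (delete_edges set0).
  apply: least; apply: induces_forest_sub fS => x y _ _ exy.
  by rewrite /delete_edges exy inE.
apply: leq_trans fvsJ _; apply: leq_trans (leq_bigmax_cond _ JE).
have [[S /existsP[X /eqP ->] <-] _] := frustration_indexP e J.
rewrite card_symdiff -(cardsID (edge_cut e X) J).
have := Jb _ (cuts X); have := cardsID J (edge_cut e X); rewrite [edge_cut e X :&: J]setIC.
by move=> <-; rewrite -addnn leq_add2l addnC leq_add2l.
Qed.

End AbstractDual.

(** * Minors of the square grid have abstract duals *)

Section Grid.
Variable n : nat.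
Local Notation point := ('I_n.+1 * 'I_n.+1)%type.
Local Notation gedge := (point * bool)%type.

(** Vertices and squares of the grid are both indexed by pairs, a square by its
    lower left corner. The coordinates are cyclic, which gives four edges to
    every vertex and to every square; the steps that do not wrap around are those
    of [grid_step]. *)
Definition step_right (p : point) : point := (ordS p.1, p.2).
Definition step_up (p : point) : point := (p.1, ordS p.2).
Definition gsrc (k : gedge) : point := k.1.
Definition gtgt (k : gedge) : point := if k.2 then step_right k.1 else step_up k.1.
Definition face1 (k : gedge) : point := k.1.
Definition face2 (k : gedge) : point :=
  if k.2 then (k.1.1, ord_pred k.1.2) else (ord_pred k.1.1, k.1.2).

Definition grid_step (p q : point) : bool :=
  ((p.1.+1 == q.1 :> nat) && (p.2 == q.2)) || ((p.1 == q.1) && (p.2.+1 == q.2 :> nat)).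

Lemma ordS_succ (i j : 'I_n.+1) : i.+1 = j :> nat -> ordS i = j.
Proof. by move=> e; apply: val_inj; rewrite /= e modn_small. Qed.

Lemma grid_stepP p q : grid_step p q ->
  exists k : gedge, gsrc k = p /\ gtgt k = q.
Proof.
case: p q => [i j] [i' j'] /orP[] /andP[/= /eqP h1 /eqP h2].
  by exists (i, j, true); rewrite /gtgt /= /step_right /= (ordS_succ h1) h2.
by exists (i, j, false); rewrite /gtgt /= /step_up /= (ordS_succ h2) h1.
Qed.

Lemma boundary_face (K : {set gedge}) f : boundary face1 face2 K f =
  ((f, true) \in K) (+) ((f, false) \in K) (+)
  ((step_up f, true) \in K) (+) ((step_right f, false) \in K).
Proof.
have one (h : gedge) : \big[addb/false]_(k : gedge) ((k \in K) && (k == h)) = (h \in K).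
  rewrite (bigD1 h) //= eqxx andbT big1 ?addbF // => k /negPf->.
  by rewrite andbF.
rewrite /boundary big_mkcond /= -!one -!big_split /=.
apply: eq_bigr => -[[i j] d] _; case: (_ \in K) => //=.
case: f => [a b]; rewrite /incident /face1 /face2 /step_up /step_right /=.
rewrite !xpair_eqE.
have eqS (x y : 'I_n.+1) : (ord_pred x == y) = (x == ordS y).
  by apply/eqP/eqP => [<-|->]; rewrite ?ord_predK ?ordSK.
by case: d; rewrite /= !xpair_eqE ?eqS !(andbT, andbF, addbF, addFb) //;
   case: (i == a); case: (j == b).
Qed.

(** Each of the four corners of a square belongs to two of its sides. *)
Lemma even_grid_cut (phi : pred point) :
  even_set face1 face2 [set k : gedge | phi (gsrc k) (+) phi (gtgt k)].
Proof.
move=> f; rewrite boundary_face !inE /gsrc /gtgt /=.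
have -> : step_right (step_up f) = step_up (step_right f) by [].
by case: (phi f); case: (phi (step_right f)); case: (phi (step_up f));
  case: (phi (step_up (step_right f))).
Qed.

(** The colour of a vertex is the parity of [K] on the path from the origin that
    goes right, then up. As squares have evenly many sides in [K], comparing two
    adjacent columns shows that horizontal edges are also accounted for. Only
    squares that do not wrap around occur. *)
Lemma even_grid_coloring (K : {set gedge}) : even_set face1 face2 K ->
  exists col : pred point, forall k, grid_step (gsrc k) (gtgt k) ->
    (k \in K) = col (gsrc k) (+) col (gtgt k).
Proof.
move=> evK.
pose P i j : point := (inord i, inord j).
pose col0 i j := (\big[addb/false]_(k < i) ((P k 0, true) \in K)) (+)
                 (\big[addb/false]_(k < j) ((P i k, false) \in K)).
have inordS i : i < n -> inord i.+1 = ordS (inord i : 'I_n.+1).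
  move=> lt; apply/esym/ordS_succ; rewrite !inordK //; exact: ltnW.
have vstep i j : col0 i j.+1 = col0 i j (+) ((P i j, false) \in K).
  by rewrite /col0 big_ord_recr /= addbA.
have hstep i j : i < n -> j <= n ->
    col0 i.+1 j = col0 i j (+) ((P i j, true) \in K).
  move=> lt; elim: j => [_|j IH jn].
    by rewrite /col0 !big_ord0 !addbF big_ord_recr.
  rewrite !vstep IH ?(ltnW jn) //.
  have := evK (P i j); rewrite boundary_face.
  have -> : step_up (P i j) = P i j.+1 by rewrite /step_up /P /= inordS.
  have -> : step_right (P i j) = P i.+1 j by rewrite /step_right /P /= inordS.
  by case: (col0 i j); case: (_ \in K); case: (_ \in K); case: (_ \in K);
     case: (_ \in K).
exists (fun p : point => col0 p.1 p.2) => -[[i j] d]; rewrite /gsrc /gtgt /=.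
have PE : P i j = (i, j) by rewrite /P !inord_val.
have contra (x : 'I_n.+1) : x.+1 = x :> nat -> False by lia.
case: d; rewrite /grid_step /=; case/orP => /andP[/eqP h1 /eqP h2].
- have lt : i < n by rewrite -ltnS h1 ltn_pmod.
  rewrite -h1 hstep //; last by rewrite -ltnS.
  by rewrite PE addbA addbb.
- by case: (contra j h2).
- by case: (contra i h1).
- by rewrite -h2 vstep PE addbA addbb.
Qed.

Variables (V : finType) (e : rel V) (B : V -> {set point}).
Hypothesis e_irr : irreflexive e.

Definition grid_connected (S : {set point}) : Prop :=
  forall col : pred point,
    {in S &, forall p q, grid_step p q -> col p = col q} ->
    {in S &, forall p q, col p = col q}.

Record grid_minor : Prop := GridMinor {
  branch_nonempty : forall v, exists p, p \in B v;
  branch_connected : forall v, grid_connected (B v);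
  branch_disjoint : forall u v p, p \in B u -> p \in B v -> u = v;
  branch_adjacent : forall u v, e u v -> exists p q,
    [/\ p \in B u, q \in B v & grid_step p q || grid_step q p] }.

Hypothesis minorP : grid_minor.

Let owner (k : gedge) : {set V} := [set v | (gsrc k \in B v) || (gtgt k \in B v)].
Let proper_edge (k : gedge) : bool := grid_step (gsrc k) (gtgt k).
Let inside (k : gedge) : bool :=
  proper_edge k && [exists v, (gsrc k \in B v) && (gtgt k \in B v)].
Let rep (E : {set V}) : gedge :=
  odflt ((ord0, ord0), true) [pick k | proper_edge k && (owner k == E)].

Let edgesP E : reflect (exists x y, e x y /\ E = [set x; y]) (E \in edges e).
Proof.
rewrite inE; apply: (iffP existsP) => [[x /existsP[y /andP[xy /eqP->]]]|[x [y [xy ->]]]].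
  by exists x, y.
by exists x; apply/existsP; exists y; rewrite xy eqxx.
Qed.

Let ownerP k x y : gsrc k \in B x -> gtgt k \in B y -> owner k = [set x; y].
Proof.
move=> kx ky; apply/setP => v; rewrite !inE; apply/orP/orP => [[h|h]|[/eqP->|/eqP->]].
- by left; rewrite (branch_disjoint minorP h kx).
- by right; rewrite (branch_disjoint minorP h ky).
- by left.
- by right.
Qed.

Let repP E : E \in edges e -> proper_edge (rep E) /\ owner (rep E) = E.
Proof.
case/edgesP => x [y [xy ->]]; rewrite /rep; case: pickP => [k /andP[? /eqP?]|no] //=.
have [p [q [px qy]]] := branch_adjacent minorP xy.
case/orP => st; have [k [k1 k2]] := grid_stepP st; have := no k.
  by rewrite /proper_edge (@ownerP k x y) ?k1 ?k2 // st eqxx.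
by rewrite /proper_edge (@ownerP k y x) ?k1 ?k2 // st setUC eqxx.
Qed.

Let rep_inj : {in edges e &, injective rep}.
Proof. by move=> E E' /repP[_ h] /repP[_ h'] eq; rewrite -h -h' eq. Qed.

Let rep_ends x y : e x y -> (gsrc (rep [set x; y]) \in B x /\ gtgt (rep [set x; y]) \in B y)
  \/ (gsrc (rep [set x; y]) \in B y /\ gtgt (rep [set x; y]) \in B x).
Proof.
move=> xy; have [|_ ow] := repP (E := [set x; y]); first by apply/edgesP; exists x, y.
set k := rep _ in ow *; move/setP: ow => ow.
have xny : x <> y by move=> eq; rewrite eq e_irr in xy.
have := ow x; have := ow y; rewrite !inE !eqxx orbT /= => /orP[hy|hy] /orP[hx|hx].
- by case: xny; exact: branch_disjoint hx hy.
- by right.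
- by left.
- by case: xny; exact: branch_disjoint hx hy.
Qed.

Let rep_not_inside E : E \in edges e -> ~~ inside (rep E).
Proof.
case/edgesP => x [y [xy ->]]; apply/negP => /andP[_ /existsP[v /andP[h1 h2]]].
have xny : x <> y by move=> eq; rewrite eq e_irr in xy.
apply: xny; case: (rep_ends xy) => -[g1 g2].
  by rewrite (branch_disjoint minorP g1 h1) (branch_disjoint minorP g2 h2).
by rewrite (branch_disjoint minorP g1 h1) (branch_disjoint minorP g2 h2).
Qed.

(** Deleted in the minor, hence contracted in the dual; the edges inside branch
    sets are contracted in the minor, hence deleted in the dual. *)
Let deleted : {set gedge} := [set k | ~~ inside k && (k \notin rep @: edges e)].
Let fold : point -> point := root (link face1 face2 deleted).

Let fold_connect p q : fold p = fold q -> connect (link face1 face2 deleted) p q.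
Proof. by move/eqP; rewrite root_connect //; exact: connect_link_sym. Qed.

Let fold_deleted k : k \in deleted -> fold (face1 k) = fold (face2 k).
Proof.
move=> kD; apply/eqP; rewrite root_connect; last exact: connect_link_sym.
by apply/connect1/(linkI kD); rewrite /joins !eqxx.
Qed.

Definition dual_source (E : {set V}) : point :=
  if E \in edges e then fold (face1 (rep E)) else (ord0, ord0).
Definition dual_target (E : {set V}) : point :=
  if E \in edges e then fold (face2 (rep E)) else (ord0, ord0).

Let boundary_rep C w : boundary dual_source dual_target C w =
  boundary (fold \o face1) (fold \o face2) (rep @: (C :&: edges e)) w.
Proof.
rewrite /boundary [RHS]big_imset /=; last first.
  by move=> E E' /setIP[_ h] /setIP[_ h']; exact: rep_inj.
rewrite (big_setID (edges e)) /= [X in _ (+) X]big1 ?addbF.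
  by apply: eq_bigr => E /setIP[_ h]; rewrite /incident /dual_source /dual_target h.
by move=> E /setDP[_ /negPf h]; rewrite /incident /dual_source /dual_target h addbb.
Qed.

Let cut_mem X x y : e x y ->
  ([set x; y] \in edge_cut e X) = (x \in X) (+) (y \in X).
Proof.
move=> xy; have xny : x != y by apply: contraTneq xy => ->; rewrite e_irr.
have Exy : [set x; y] \in edges e by apply/edgesP; exists x, y.
rewrite inE Exy /=.
case: (boolP (x \in X)) => xX; case: (boolP (y \in X)) => yX /=.
- have -> : [set x; y] :&: X = [set x; y].
    by apply/setIidPl; rewrite subUset !sub1set xX yX.
  by rewrite cards2 xny.
- have -> : [set x; y] :&: X = [set x].
    apply/setP => z; rewrite !inE; case: eqP => [->|] //=; case: eqP => [->|] //=.
    by rewrite (negPf yX).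
  by rewrite cards1.
- have -> : [set x; y] :&: X = [set y].
    apply/setP => z; rewrite !inE orbC; case: eqP => [->|] //=; case: eqP => [->|] //=.
    by rewrite (negPf xX).
  by rewrite cards1.
have -> : [set x; y] :&: X = set0.
  apply/setP => z; rewrite !inE; case: eqP => [->|_] /=; first by rewrite (negPf xX).
  by case: eqP => [->|] //=; rewrite (negPf yX).
by rewrite cards0.
Qed.

(** A cut of the graph comes from a cut of the grid, which is even, and differs
    from it by deleted edges. Conversely an even set can be completed by deleted
    edges to an even set of the dual grid; the colouring that this defines does
    not change inside a branch set, so it colours the vertices of the graph. *)
Lemma grid_minor_dual : abstract_dual e dual_source dual_target.
Proof.
split=> [E nE|X w|C evC].
- by rewrite /dual_source /dual_target (negPf nE).
- pose phi p := [exists v in X, p \in B v].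
  have phiE v p : p \in B v -> phi p = (v \in X).
    move=> pv; apply/existsP/idP => [[u /andP[uX pu]]|vX]; last by exists v; rewrite vX.
    by rewrite (branch_disjoint minorP pv pu).
  pose K := [set k : gedge | phi (gsrc k) (+) phi (gtgt k)].
  have evK : boundary (fold \o face1) (fold \o face2) K w = false.
    by rewrite boundary_comp big1 // => f _; exact: even_grid_cut.
  rewrite boundary_rep -evK; have -> : edge_cut e X :&: edges e = edge_cut e X.
    by apply/setIidPl/subsetP => E; rewrite !inE => /andP[].
  have repK x y : e x y -> (rep [set x; y] \in K) = (x \in X) (+) (y \in X).
    move=> xy; rewrite inE; case: (rep_ends xy) => -[h1 h2].
      by rewrite (phiE _ _ h1) (phiE _ _ h2).
    by rewrite (phiE _ _ h1) (phiE _ _ h2) addbC.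
  have sub : rep @: edge_cut e X \subset K.
    apply/subsetP => _ /imsetP[E EX ->]; move: (EX); rewrite inE => /andP[/edgesP[x [y [xy eE]]] _].
    by rewrite eE repK // -cut_mem // -eE.
  rewrite [RHS]/boundary (big_setID (rep @: edge_cut e X)) /= (setIidPr sub).
  rewrite [X in _ (+) X]big1 ?addbF // => k /setDP[kK nk].
  rewrite /incident /= fold_deleted ?addbb // inE; apply/andP; split.
    apply/negP => /andP[_ /existsP[v /andP[h1 h2]]].
    by move: kK; rewrite inE (phiE _ _ h1) (phiE _ _ h2) addbb.
  apply: contra nk => /imsetP[E Ee ek]; rewrite ek imset_f //.
  case/edgesP: Ee ek => x [y [xy ->]] ek.
  by rewrite cut_mem // -repK // -ek.
have ev : even_set (fold \o face1) (fold \o face2) (rep @: (C :&: edges e)).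
  by move=> w; rewrite -boundary_rep.
have [D DD evK] := even_completion fold_connect ev.
have [col colK] := even_grid_coloring evK.
set K := symdiff _ _ in evK colK.
have mem_inside k : inside k -> k \notin K.
  move=> ik; rewrite in_symdiff.
  have -> : (k \in D) = false.
    by apply: contraTF ik => /(subsetP DD); rewrite inE => /andP[].
  rewrite addbF; apply: contraL ik => /imsetP[E /setIP[_ Ee] ->].
  exact: rep_not_inside.
have col_const v p q : p \in B v -> q \in B v -> col p = col q.
  apply: branch_connected => // a b av bv st.
  have [k [k1 k2]] := grid_stepP st.
  have := mem_inside k; rewrite /inside /proper_edge colK k1 k2 // st /=.
  have -> /= : [exists v, (a \in B v) && (b \in B v)].
    by apply/existsP; exists v; rewrite av bv.
  by move/(_ isT); case: (col a); case: (col b).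
pose X := [set v | [exists p in B v, col p]].
have colX v p : p \in B v -> col p = (v \in X).
  move=> pv; rewrite inE; apply/idP/existsP => [cp|[q /andP[qv cq]]].
    by exists p; rewrite pv.
  by rewrite (col_const v p q).
exists X => x y xy.
have Exy : [set x; y] \in edges e by apply/edgesP; exists x, y.
have [pr _] := repP Exy.
have -> : ([set x; y] \in C) = (rep [set x; y] \in K).
  rewrite in_symdiff.
  have -> : (rep [set x; y] \in D) = false.
    apply/negbTE/negP => /(subsetP DD); rewrite inE => /andP[_ /negP]; apply.
    exact: imset_f.
  rewrite addbF; apply/idP/imsetP => [h|[E /setIP[EC Ee] /rep_inj-> //]].
  by exists [set x; y] => //; rewrite inE h.
rewrite (colK _ pr); case: (rep_ends xy) => -[h1 h2].
  by rewrite (colX _ _ h1) (colX _ _ h2).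
by rewrite (colX _ _ h1) (colX _ _ h2) addbC.
Qed.

End Grid.

(** * From thickened drawings to grid minors *)

Section Thickening.
Variables (n : nat) (V : finType) (e : rel V).
Local Notation point := ('I_n.+1 * 'I_n.+1)%type.
Hypotheses (e_sym : symmetric e) (e_irr : irreflexive e).
Variables (NV : V -> {set point}) (NE : {set V} -> {set point}).
Variables (start stop : {set V} -> pred V).

(** [NV v] is meant to cover a vertex and the adjacent thirds of its arcs, and
    [NE E] the middle third of an arc. *)
Record thick_drawing : Prop := ThickDrawing {
  vertex_nonempty : forall v, exists p, p \in NV v;
  vertex_connected : forall v, grid_connected (NV v);
  edge_connected : forall E, E \in edges e -> grid_connected (NE E);
  start_unique : forall E u v, start E u -> start E v -> u = v;
  stop_unique : forall E u v, stop E u -> stop E v -> u = v;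
  edge_ends : forall x y, e x y ->
    (start [set x; y] x && stop [set x; y] y) ||
    (start [set x; y] y && stop [set x; y] x);
  start_meets : forall E v, E \in edges e -> start E v -> exists p, p \in NE E :&: NV v;
  stop_meets : forall E v, E \in edges e -> stop E v -> exists p, p \in NE E :&: NV v;
  vertices_apart : forall u v p, p \in NV u -> p \in NV v -> u = v;
  edges_apart : forall E E' p, E \in edges e -> E' \in edges e ->
    p \in NE E -> p \in NE E' -> E = E';
  vertex_edge_apart : forall v E p, E \in edges e -> p \in NV v -> p \in NE E ->
    start E v || stop E v }.

Hypothesis td : thick_drawing.

Let walk (E : {set V}) (w : V) : rel point := fun p q =>
  (q \in NE E :\: NV w) && (grid_step p q || grid_step q p).

(** What can be reached from [NV v] inside [NE E] without entering [NV w]: giving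
    it to the first end of [E] makes the branch sets of both ends adjacent. *)
Definition tentacle (E : {set V}) (v w : V) : {set point} :=
  [set q | [exists p in NV v, connect (walk E w) p q]].

Definition branch (v : V) : {set point} :=
  NV v :|: [set q | [exists E in edges e, [exists w,
     [&& start E v, stop E w & q \in tentacle E v w]]]].

Let tentacleP E v w q : q \in tentacle E v w -> q \in NV v \/ q \in NE E :\: NV w.
Proof.
rewrite inE => /existsP[p /andP[pv /connectP[s pth ->]]] {q}.
case/lastP: s pth => [|s q]; first by left.
by rewrite rcons_path last_rcons => /andP[_ /andP[qE _]]; right.
Qed.

Let tentacle_sub E v w : E \in edges e -> start E v -> stop E w ->
  tentacle E v w \subset branch v.
Proof.
move=> Ee Ev Ew; apply/subsetP => q qT; apply/setUP; right; rewrite inE.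
by apply/existsP; exists E; rewrite Ee; apply/existsP; exists w; rewrite Ev Ew.
Qed.

Let branchP v q : q \in branch v -> q \in NV v \/
  exists E w, [/\ E \in edges e, start E v, stop E w & q \in tentacle E v w].
Proof.
case/setUP => [|]; first by left.
rewrite inE => /existsP[E /andP[Ee /existsP[w /and3P[Ev Ew qT]]]].
by right; exists E, w.
Qed.

Let branch_conn v : grid_connected (branch v).
Proof.
move=> col colP.
have NVB : NV v \subset branch v by exact: subsetUl.
have [p0 p0v] := vertex_nonempty td v.
suff all0 p : p \in branch v -> col p = col p0 by move=> p q /all0-> /all0->.
have base q : q \in NV v -> col q = col p0.
  move=> qv; apply: (vertex_connected td (v := v)) => // a b av bv.
  by apply: colP; exact: (subsetP NVB).
case/branchP => [|[E [w [Ee Ev Ew]]]]; first exact: base.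
rewrite inE => /existsP[a /andP[av /connectP[s]]].
have reach a' : a' \in tentacle E v w -> col a' = col p0 ->
    path (walk E w) a' s -> col (last a' s) = col p0.
  elim: s a' => [|b s IH] a' //= aT ca /andP[ab pth].
  have bT : b \in tentacle E v w.
    move: aT; rewrite !inE => /existsP[c /andP[cv cc]].
    by apply/existsP; exists c; rewrite cv (connect_trans cc) ?connect1.
  apply: IH => //; rewrite -ca.
  have sub := subsetP (tentacle_sub Ee Ev Ew).
  case/andP: ab => _ /orP[st|st]; first by apply/esym/colP => //; exact: sub.
  by apply: colP => //; exact: sub.
move=> pth ->; apply: reach (base _ av) pth.
by rewrite inE; apply/existsP; exists a; rewrite av connect0.
Qed.

Let branch_disj u v p : p \in branch u -> p \in branch v -> u = v.
Proof.
have VE x y E w : E \in edges e -> start E y -> stop E w ->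
    p \in NV x -> p \in NE E :\: NV w -> x = y.
  move=> Ee Ey Ew px /setDP[pE pw].
  have /orP[Ex|Ex] := vertex_edge_apart td Ee px pE; first exact: (start_unique td Ex Ey).
  by rewrite -(stop_unique td Ex Ew) px in pw.
move=> /branchP[pu|[E [w [Ee Eu Ew /tentacleP[pu|pE]]]]];
  move=> /branchP[pv|[E' [w' [Ee' Ev' Ew' /tentacleP[pv|pE']]]]];
  try exact: (vertices_apart td pu pv).
- exact: (VE u v E' w').
- exact: (VE u v E' w').
- by apply/esym; exact: (VE v u E w).
- by apply/esym; exact: (VE v u E w).
have /setDP[h _] := pE; have /setDP[h' _] := pE'.
have eE := edges_apart td Ee Ee' h h'; rewrite -eE in Ev'.
exact: (start_unique td Eu Ev').
Qed.

Let branch_adj u v : e u v -> exists p q,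
  [/\ p \in branch u, q \in branch v & grid_step p q || grid_step q p].
Proof.
wlog /andP[Eu Ev] : u v / start [set u; v] u && stop [set u; v] v.
  move=> wl uv; have /orP[h|h] := edge_ends td uv; first exact: wl.
  have [||p [q [pv qu st]]] := wl v u; rewrite ?[[set v; u]]setUC // 1?e_sym //.
  by exists q, p; rewrite orbC.
move=> uv; set E := [set u; v] in Eu Ev.
have Ee : E \in edges e.
  by rewrite inE; apply/existsP; exists u; apply/existsP; exists v; rewrite uv eqxx.
case: (pickP [pred pq : point * point | [&& pq.1 \in tentacle E u v, pq.2 \in NV v &
    grid_step pq.1 pq.2 || grid_step pq.2 pq.1]]) => [[p q] /= /and3P[pT qv st]|no].
  exists p, q; split=> //; first exact: (subsetP (tentacle_sub Ee Eu Ev)).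
  by rewrite inE qv.
have sub : NV u \subset tentacle E u v.
  apply/subsetP => a au; rewrite inE; apply/existsP; exists a; rewrite au.
  exact: connect0.
have stepT a b : a \in tentacle E u v -> b \in NE E -> grid_step a b || grid_step b a ->
    b \in tentacle E u v.
  move=> aT bE st; have := no (a, b); rewrite /= aT st andbT /= => bv.
  move: aT; rewrite !inE => /existsP[c /andP[cu cc]]; apply/existsP; exists c.
  rewrite cu (connect_trans cc) // connect1 // /walk st andbT inE bv.
  exact: bE.
have const : {in NE E &, forall a b, (a \in tentacle E u v) = (b \in tentacle E u v)}.
  apply: (edge_connected td Ee) => a b aE bE st.
  by apply/idP/idP => h; apply: stepT h _ _; rewrite ?st ?orbT.
have [a /setIP[aE au]] := start_meets td Ee Eu.
have [b /setIP[bE bv]] := stop_meets td Ee Ev.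
have : b \in tentacle E u v by rewrite -(const a) // (subsetP sub).
case/tentacleP => [bu|]; last by rewrite inE bv.
by move: uv; rewrite (vertices_apart td bu bv) e_irr.
Qed.

Lemma thick_drawing_minor : grid_minor e branch.
Proof.
split=> //; first by move=> v; have [p pv] := vertex_nonempty td v; exists p; rewrite inE pv.
Qed.

End Thickening.

From mathcomp Require Import all_order all_algebra lra.
From mathcomp Require Import all_classical all_reals all_analysis.

Import Order.TTheory GRing.Theory Num.Theory.
Import numFieldNormedType.Exports.

(** * Compact sets and square cells *)

Section Compactness.
Local Open Scope classical_set_scope.
Local Open Scope ring_scope.
Variable R : realType.
Implicit Types K L : set (R * R).

Lemma compact_apart K L : compact K -> compact L -> K `&` L = set0 ->
  exists2 d : R, 0 < d & forall a b, K a -> L b -> d <= `|a - b|.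
Proof.
move=> cK cL KL0; have [KL|/set0P[z0 KLz0]] := eqVneq (K `*` L) set0.
  exists 1; first exact: ltr01.
  by move=> a b Ka Lb; have : (K `*` L) (a, b) by []; rewrite KL.
have cf : {within K `*` L, continuous (fun z : (R * R) * (R * R) => `|z.1 - z.2|)}.
  apply: continuous_subspaceT => z; apply: cvg_norm; apply: cvgB; [exact: cvg_fst|exact: cvg_snd].
have [|c /set_mem[Kc Lc] minc] := compact_EVT_min _ (compact_setX cK cL) cf.
  by exists z0.
exists `|c.1 - c.2|.
  rewrite normr_gt0 subr_eq0; apply/eqP => e.
  have : (K `&` L) c.1 by split=> //; rewrite e.
  by rewrite KL0.
by move=> a b Ka Lb; apply: (minc (a, b)); apply/mem_set.
Qed.

Lemma uniform_pos (T : finType) (P : T -> R -> Prop) :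
  (forall i d d', 0 < d' -> d' <= d -> P i d -> P i d') ->
  (forall i, exists2 d, 0 < d & P i d) -> exists2 d, 0 < d & forall i, P i d.
Proof.
move=> mono each.
suff [d d0 h] : exists2 d, 0 < d & forall i, i \in enum T -> P i d.
  by exists d => // i; apply: h; rewrite mem_enum.
elim: (enum T) => [|i s [d d0 h]]; first by exists 1; first exact: ltr01.
have [d1 d10 h1] := each i; exists (Num.min d d1).
  by rewrite lt_min d0 d10.
have m0 : 0 < Num.min d d1 by rewrite lt_min d0 d10.
move=> j; rewrite inE => /orP[/eqP->|/h Pj].
  by apply: mono h1 => //; rewrite ge_min lexx orbT.
by apply: mono Pj => //; rewrite ge_min lexx.
Qed.

Lemma compact_norm_bound K : compact K -> exists2 d, 0 < d & forall a, K a -> `|a| <= d^-1.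
Proof.
move=> /compact_bounded; rewrite /bounded_set /bounded_near => /pinfty_ex_gt0[M M0 h].
by exists M^-1; rewrite ?invr_gt0 // => a Ka; rewrite invrK; exact: h.
Qed.
End Compactness.

Section Cells.
Local Open Scope classical_set_scope.
Local Open Scope ring_scope.
Variables (R : realType) (M eps : R).
Hypothesis eps0 : 0 < eps.

Definition cell_index (x : R) : nat := Num.truncn ((x + M) / eps).
Definition mesh : nat := cell_index M.
Local Notation point := ('I_mesh.+1 * 'I_mesh.+1)%type.

Let scaled_ge0 x : `|x| <= M -> 0 <= (x + M) / eps.
Proof. by rewrite ler_norml => /andP[h _]; rewrite divr_ge0 ?(ltW eps0) //; lra. Qed.

Lemma cell_index_close x y : `|x| <= M -> `|y| <= M -> `|x - y| < eps ->
  (cell_index x <= (cell_index y).+1)%N.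
Proof.
move=> xM yM xy; rewrite /cell_index.
have /andP[h1 h2] := truncn_itv (scaled_ge0 xM).
have /andP[h3 h4] := truncn_itv (scaled_ge0 yM).
have h : (x + M) / eps < (y + M) / eps + 1.
  rewrite ltr_pdivrMr // mulrDl divfK ?gt_eqF // mul1r.
  by move: xy; rewrite ltr_norml => /andP[_]; lra.
rewrite -ltnS -(ltr_nat R); apply: le_lt_trans h1 _; apply: lt_trans h _.
by rewrite -[X in _ < X]natr1 ltrD2r.
Qed.

Lemma cell_index_apart x y : `|x| <= M -> `|y| <= M ->
  (cell_index x <= (cell_index y).+2)%N -> (cell_index y <= (cell_index x).+2)%N -> `|x - y| < 3 * eps.
Proof.
have half u v : `|u| <= M -> `|v| <= M -> (cell_index u <= (cell_index v).+2)%N -> u - v < 3 * eps.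
  move=> uM vM; rewrite /cell_index => le.
  have /andP[h1 h2] := truncn_itv (scaled_ge0 uM).
  have /andP[h3 h4] := truncn_itv (scaled_ge0 vM).
  have h : (u + M) / eps < (v + M) / eps + 3.
    apply: lt_le_trans h2 _; apply: le_trans (_ : (Num.truncn ((v + M) / eps)).+3%:R <= _).
      by rewrite ler_nat ltnS.
    by rewrite -addn3 natrD lerD2r.
  have {}h : (u + M) / eps * eps < ((v + M) / eps + 3) * eps by rewrite ltr_pM2r.
  by move: h; rewrite divfK ?gt_eqF // mulrDl divfK ?gt_eqF //; lra.
move=> xM yM xy yx; rewrite ltr_norml; apply/andP; split; last exact: half.
by rewrite ltrNl opprB; exact: half.
Qed.

Lemma cell_index_le_mesh x : `|x| <= M -> (cell_index x <= mesh)%N.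
Proof.
move=> xM; apply: le_truncn.
rewrite ler_pM2r ?invr_gt0 // lerD2r; exact: le_trans (ler_norm x) xM.
Qed.

(** The block of three by three cells around [z], which contains the cell of each
    point at distance less than [eps]. *)
Definition near_cell (z : R * R) (p : point) : bool :=
  [&& (p.1 <= (cell_index z.1).+1)%N, (cell_index z.1 <= p.1.+1)%N,
      (p.2 <= (cell_index z.2).+1)%N & (cell_index z.2 <= p.2.+1)%N].

Definition cells (K : set (R * R)) : {set point} :=
  finset (fun p => `[< exists2 z, K z & near_cell z p >]).

Lemma cellsP K p : reflect (exists2 z, K z & near_cell z p) (p \in cells K).
Proof. by rewrite inE; apply: asboolP. Qed.

Definition bounded_by_M (K : set (R * R)) : Prop := forall z, K z -> `|z| <= M.

Let norm1 (z : R * R) : `|z| <= M -> `|z.1| <= M.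
Proof. by rewrite prod_normE ge_max => /andP[]. Qed.
Let norm2 (z : R * R) : `|z| <= M -> `|z.2| <= M.
Proof. by rewrite prod_normE ge_max => /andP[]. Qed.

Definition center (z : R * R) : point := (inord (cell_index z.1), inord (cell_index z.2)).

Let center1 z : `|z| <= M -> (center z).1 = cell_index z.1 :> nat.
Proof. by move=> /norm1/cell_index_le_mesh h; rewrite inordK. Qed.
Let center2 z : `|z| <= M -> (center z).2 = cell_index z.2 :> nat.
Proof. by move=> /norm2/cell_index_le_mesh h; rewrite inordK. Qed.

Lemma center_near z z' : `|z| <= M -> `|z'| <= M -> `|z - z'| < eps ->
  near_cell z (center z').
Proof.
move=> zM z'M; rewrite prod_normE gt_max /= => /andP[h1 h2].
rewrite /near_cell center1 // center2 //.
have e1 : `|z'.1 - z.1| < eps by rewrite distrC.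
have e2 : `|z'.2 - z.2| < eps by rewrite distrC.
by rewrite !cell_index_close ?norm1 ?norm2.
Qed.

Lemma center_cells K z : bounded_by_M K -> K z -> center z \in cells K.
Proof.
move=> KM Kz; apply/cellsP; exists z => //.
by apply: center_near; rewrite ?KM // subrr normr0.
Qed.

Lemma cells_meet K L : (K `&` L !=set0) -> bounded_by_M K -> exists p, p \in (cells K :&: cells L)%SET.
Proof.
case=> z [Kz Lz] KM; exists (center z); rewrite inE center_cells //=.
apply/cellsP; exists z => //.
by apply: center_near; rewrite ?KM // subrr normr0.
Qed.

Lemma cells_apart K L : bounded_by_M K -> bounded_by_M L ->
  (forall a b, K a -> L b -> 3 * eps <= `|a - b|) ->
  forall p, p \in cells K -> p \in cells L -> False.
Proof.
move=> KM LM apart p /cellsP[a Ka /and4P[a1 a2 a3 a4]] /cellsP[b Lb /and4P[b1 b2 b3 b4]].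
have := apart a b Ka Lb; rewrite leNgt => /negP; apply.
rewrite prod_normE gt_max /=; apply/andP; split.
  apply: cell_index_apart; [exact/norm1/KM|exact/norm1/LM|clear - a1 a2 b1 b2; lia..].
apply: cell_index_apart; [exact/norm2/KM|exact/norm2/LM|clear - a3 a4 b3 b4; lia..].
Qed.

Lemma near_cell_connected z (col : pred point) : `|z| <= M ->
  (forall p q, near_cell z p -> near_cell z q -> grid_step p q -> col p = col q) ->
  forall p, near_cell z p -> col p = col (center z).
Proof.
move=> zM colP [i j] near_p.
move: (center1 zM) (center2 zM); case: (center z) => i0 j0 /= c1 c2.
move: (near_p) => /and4P /= [h1 h2 h3 h4].
have near_q : near_cell z (i, j0) by rewrite /near_cell /= c2 h1 h2 !leqnSn.
have near_c : near_cell z (i0, j0) by rewrite /near_cell /= c1 c2 !leqnSn.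
have -> : col (i, j) = col (i, j0).
  have [lt|gt|e] := ltngtP j j0; last by rewrite (val_inj e).
    apply: colP => //; rewrite /grid_step /= eqxx orbC /= eqn_leq lt /=.
    by rewrite c2 h4.
  apply/esym/colP => //; rewrite /grid_step /= eqxx orbC /= eqn_leq gt /=.
  by rewrite c2 h3.
have [lt|gt|e] := ltngtP i i0; last by rewrite (val_inj e).
  by apply: colP => //; rewrite /grid_step /= eqxx andbT eqn_leq lt c1 h2.
by apply/esym/colP => //; rewrite /grid_step /= eqxx andbT eqn_leq gt c1 h1.
Qed.

(** A colour that is constant along steps is constant on each block, and blocks of
    close points overlap; so the colour of the block of [z] is locally constant
    in [z], hence constant on the connected set [K]. *)
Lemma cells_connected K : bounded_by_M K -> connected K -> grid_connected (cells K).
Proof.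
move=> KM cK col colP.
have colz z p : K z -> near_cell z p -> col p = col (center z).
  move=> Kz; apply: near_cell_connected; first exact: KM.
  by move=> a b az bz; apply: colP; apply/cellsP; exists z.
pose O b := \bigcup_(z in [set z | K z /\ col (center z) = b]) ball z eps.
have Oopen b : open (O b) by apply: bigcup_open => z _; exact: ball_open.
have KO b : K `&` O b = [set z | K z /\ col (center z) = b].
  apply/seteqP; split=> [x [Kx [z [Kz cz]]]|x [Kx cx]]; last first.
    by split=> //; exists x => //; exact: ballxx.
  rewrite -ball_normE /= => zx; split=> //; rewrite -cz.
  exact: colz Kz (center_near (KM z Kz) (KM x Kx) zx).
have same z z' : K z -> K z' -> col (center z) = col (center z').
  move=> Kz Kz'; set b := col (center z').
  have : K `&` O b = K.
    apply: cK; first by exists z'; rewrite KO.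
      by exists (O b); [exact: Oopen|].
    exists (~` O (~~ b)); first exact: open_closedC.
    apply/seteqP; split=> x [Kx h]; split=> //.
      have : (K `&` O b) x by [].
      rewrite KO => -[_ cx] nx; have : (K `&` O (~~ b)) x by [].
      by rewrite KO => -[_]; rewrite cx; case: (b).
    have [cx|cx] := eqVneq (col (center x)) b.
      have : (K `&` O b) x by rewrite KO.
      by case.
    case: h; have : (K `&` O (~~ b)) x.
      by rewrite KO; split=> //; move: cx; case: (col _); case: (b).
    by case.
  by rewrite KO => /seteqP[_ /(_ z Kz)[]].
move=> p q /cellsP[z Kz zp] /cellsP[z' Kz' zq].
by rewrite (colz z p) // (colz z' q) // (same z z').
Qed.

End Cells.

(** * Thickening a plane drawing *)

Section PlaneDrawing.
Local Open Scope classical_set_scope.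
Local Open Scope ring_scope.
Variables (R : realType) (V : finType) (e : rel V).
Hypothesis e_sym : symmetric e.
Variables (pos : V -> R * R) (arc : {set V} -> R -> R * R).
Hypothesis drawing : plane_drawing e pos arc.

Let start (E : {set V}) : pred V := fun v => `[< arc E 0 = pos v >].
Let stop (E : {set V}) : pred V := fun v => `[< arc E 1 = pos v >].

Definition at_vertex (v : V) (i : option ({set V} * bool)) : bool :=
  if i is Some (E, b) then (E \in edges e) && (if b then start E v else stop E v)
  else true.

Definition spoke (v : V) (i : option ({set V} * bool)) : set (R * R) :=
  if i is Some (E, b) then
    arc E @` [set` if b then `[0, 1 / 3] else `[2 / 3, 1]]
  else [set pos v].

(** The union of the arcs' thirds next to [v]; it contains [pos v] even if no edge
    ends at [v]. *)
Definition star (v : V) : set (R * R) :=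
  \bigcup_(i in [set i | at_vertex v i]) spoke v i.

Definition middle (E : {set V}) : set (R * R) := arc E @` `[1 / 3, 2 / 3].

Let edge_endpoints E : E \in edges e -> exists x y, [/\ e x y, E = [set x; y]%SET,
  arc E 0 = pos x & arc E 1 = pos y].
Proof.
rewrite inE => /existsP[x /existsP[y /andP[xy /eqP ->]]].
have [[h0 h1]|[h0 h1]] := arc_ends drawing xy; first by exists x, y.
by exists y, x; split=> //; [rewrite e_sym | exact: finset.setUC].
Qed.

Let arc_within E (a b : R) : E \in edges e -> 0 <= a -> b <= 1 ->
  {within `[a, b], continuous (arc E)}.
Proof.
move=> Ee a0 b1; have [cE _] := arc_simple drawing Ee.
apply: continuous_subspaceW cE => t /=; rewrite !in_itv /= => /andP[h1 h2].
by rewrite (le_trans a0 h1) (le_trans h2 b1).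
Qed.

Let spoke_within v i : at_vertex v i -> compact (spoke v i) /\ connected (spoke v i).
Proof.
case: i => [[E b]|] /=; last by move=> _; split; [exact: compact_set1 | exact: connected1].
case/andP => Ee _; split.
  by case: b; apply: continuous_compact; try exact: segment_compact;
     apply: arc_within => //; lra.
by case: b; apply: connected_continuous_connected; try exact: segment_connected;
   apply: arc_within => //; lra.
Qed.

Let spoke_hub v i : at_vertex v i -> spoke v i (pos v).
Proof.
case: i => [[E []]|] //= /andP[_ /asboolP h].
  by exists 0; rewrite //= in_itv /=; lra.
by exists 1; rewrite //= in_itv /=; lra.
Qed.

Lemma star_compact v : compact (star v).
Proof.
rewrite /star; have -> : [set i | at_vertex v i] =
    [set i | (i \in enum {: option ({set V} * bool)}) && at_vertex v i].
  by apply/seteqP; split=> i /=; rewrite mem_enum.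
rewrite bigcup_seq_cond; apply: bigsetU_compact => i.
by case/spoke_within.
Qed.

Lemma star_connected v : connected (star v).
Proof.
apply: bigcup_connected; first by exists (pos v) => i /spoke_hub.
by move=> i /spoke_within[].
Qed.

Lemma middle_compact E : E \in edges e -> compact (middle E).
Proof.
move=> Ee; apply: continuous_compact; last exact: segment_compact.
by apply: arc_within => //; lra.
Qed.

Lemma middle_connected E : E \in edges e -> connected (middle E).
Proof.
move=> Ee; apply: connected_continuous_connected; first exact: segment_connected.
by apply: arc_within => //; lra.
Qed.

Let same_point E E' (t t' : R) : E \in edges e -> E' \in edges e -> 0 < t < 1 ->
  0 <= t' <= 1 -> arc E t = arc E' t' -> E = E' /\ t = t'.
Proof.
move=> Ee Ee' /andP[t0 t1] /andP[t'0 t'1] eq.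
have [x [y [_ _ a0 a1]]] := edge_endpoints Ee'.
have t01 : 0 < t < 1 by rewrite t0.
have [z|n0] := eqVneq t' 0.
  by have := arc_avoids_vertices drawing (v := x) Ee t01; rewrite eq z a0.
have [z|n1] := eqVneq t' 1.
  by have := arc_avoids_vertices drawing (v := y) Ee t01; rewrite eq z a1.
have t'01 : 0 < t' < 1 by rewrite !lt_neqAle eq_sym n0 t'0 n1 t'1.
have [eE|nE] := eqVneq E E'; last first.
  by have := arc_disjoint drawing Ee Ee' (elimN eqP nE) t01 t'01.
split=> //; rewrite -eE in eq.
have [_ inj] := arc_simple drawing Ee.
by apply: inj eq; rewrite in_itv /=; lra.
Qed.

Let star_point v x : star v x -> x = pos v \/ exists E (t : R),
  [/\ E \in edges e, 0 < t < 1, x = arc E t &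
      t <= 1 / 3 /\ start E v \/ 2 / 3 <= t /\ stop E v].
Proof.
case=> -[[E b]|] /=; last by move=> _ ->; left.
case/andP => Ee hub [t]; case: b hub => hub; rewrite /= in_itv /= => /andP[t0 t1] <-.
  have [->|n] := eqVneq t 0; first by left; apply/asboolP.
  right; exists E, t; split=> //; last by left.
  by rewrite lt_neqAle eq_sym n t0 /=; lra.
have [->|n] := eqVneq t 1; first by left; apply/asboolP.
right; exists E, t; split=> //; last by right.
by rewrite [X in _ && X]lt_neqAle n t1 andbT /=; lra.
Qed.

Let middle_point E x : middle E x -> exists2 t, 1 / 3 <= t <= 2 / 3 & x = arc E t.
Proof. by case=> t /=; rewrite in_itv /= => h <-; exists t. Qed.

Let start_inj E u v : start E u -> start E v -> u = v.
Proof. by move=> /asboolP h /asboolP h'; apply: (pos_inj drawing); rewrite -h h'. Qed.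
Let stop_inj E u v : stop E u -> stop E v -> u = v.
Proof. by move=> /asboolP h /asboolP h'; apply: (pos_inj drawing); rewrite -h h'. Qed.

Lemma stars_disjoint u v x : star u x -> star v x -> u = v.
Proof.
move=> /star_point[->|[E [t [Ee t01 -> hu]]]] /star_point[|[E' [t' [Ee' t'01]]]].
- exact: (pos_inj drawing).
- by move=> eq; case: (arc_avoids_vertices drawing (v := u) Ee' t'01).
- by move=> eq; case: (arc_avoids_vertices drawing (v := v) Ee t01).
have t'01' : 0 <= t' <= 1 by case/andP: t'01 => h1 h2; rewrite !ltW.
move=> /(same_point Ee Ee' t01 t'01')[eE et]; rewrite -eE -et.
case: hu => -[h1 h2] [] [h3 h4]; [exact: start_inj h2 h4 | exfalso; lra | exfalso; lra | exact: stop_inj h2 h4].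
Qed.

Lemma middles_disjoint E E' x : E \in edges e -> E' \in edges e ->
  middle E x -> middle E' x -> E = E'.
Proof.
move=> Ee Ee' /middle_point[t t01 ->] /middle_point[t' t'01] eq.
by have [] := same_point Ee Ee' _ _ eq => //; lra.
Qed.

Lemma star_middle v E x : E \in edges e -> star v x -> middle E x ->
  start E v || stop E v.
Proof.
move=> Ee vx /middle_point[t t01 ex]; move: vx; rewrite ex => /star_point.
have t01' : 0 < t < 1 by lra.
case=> [eq|[E' [t' [Ee' t'01 eq h]]]].
  by case: (arc_avoids_vertices drawing (v := v) Ee t01').
have t'01' : 0 <= t' <= 1 by case/andP: t'01 => h1 h2; rewrite !ltW.
have [-> _] := same_point Ee Ee' t01' t'01' eq.
by case: h => -[_ ->]; rewrite ?orbT.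
Qed.

Let part (i : V + {set V}) : set (R * R) :=
  match i with inl v => star v | inr E => if E \in edges e then middle E else set0 end.

Let part_compact i : compact (part i).
Proof.
case: i => [v|E] /=; first exact: star_compact.
by case: ifP => [|_]; [exact: middle_compact | exact: compact0].
Qed.

(** Three cells are made smaller than all distances between disjoint parts, so
    that parts whose cells meet have a common point. *)
Lemma plane_thick_drawing : exists n (NV : V -> {set 'I_n.+1 * 'I_n.+1})
    (NE : {set V} -> {set 'I_n.+1 * 'I_n.+1}), thick_drawing e NV NE start stop.
Proof.
have [d d0 dP] : exists2 d : R, 0 < d & forall ij : (V + {set V}) * (V + {set V}),
    part ij.1 `&` part ij.2 = set0 ->
    forall a b, part ij.1 a -> part ij.2 b -> d <= `|a - b|.
  apply: uniform_pos => [ij x y _ xy h dis a b pa pb|[i j] /=].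
    exact: le_trans xy (h dis a b pa pb).
  have [dis|ndis] := pselect (part i `&` part j = set0); last first.
    by exists 1; first exact: ltr01.
  have [x x0 h] := compact_apart (@part_compact i) (@part_compact j) dis.
  by exists x.
have [c c0 cP] : exists2 c : R, 0 < c & forall i a, part i a -> `|a| <= c^-1.
  apply: uniform_pos => [i x y y0 yx h a pa|i]; last exact: compact_norm_bound.
  by apply: le_trans (h a pa) _; rewrite lef_pV2 // posrE // (lt_le_trans y0).
(* Points in cells at most two steps apart are at distance less than [3 * eps]. *)
pose M := c^-1; pose eps := d / 3.
have eps0 : 0 < eps by rewrite divr_gt0.
have eps3 : 3 * eps = d by rewrite /eps mulrC divfK.
have apart i j p : p \in cells M eps (part i) -> p \in cells M eps (part j) ->
    exists x, part i x /\ part j x.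
  move=> pi pj; apply: contrapT => no.
  apply: (cells_apart eps0 _ _ _ pi pj).
  - exact: cP.
  - exact: cP.
  - rewrite eps3; apply: (dP (i, j)); apply/seteqP; split=> // x [h1 h2].
    by apply: no; exists x.
have partE E : E \in edges e -> part (inr E) = middle E by move=> Ee; rewrite /= Ee.
have meet E v x : star v x -> middle E x -> E \in edges e ->
    exists p, p \in (cells M eps (middle E) :&: cells M eps (star v))%SET.
  move=> vx Ex Ee; apply: cells_meet => //; first by exists x.
  by rewrite -partE //; exact: cP.
exists (mesh M eps), (fun v => cells M eps (star v)), (fun E => cells M eps (middle E)).
split.
- move=> v; exists (center M eps (pos v)).
  apply: center_cells => //; first exact: (cP (inl v)).
  by exists None.
- move=> v; apply: cells_connected => //; first exact: (cP (inl v)).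
  exact: star_connected.
- move=> E Ee; apply: cells_connected => //; last exact: middle_connected.
  by rewrite -partE //; exact: cP.
- exact: start_inj.
- exact: stop_inj.
- move=> x y xy; case: (arc_ends drawing xy) => -[h0 h1]; apply/orP; [left|right];
  by apply/andP; split; apply/asboolP.
- move=> E v Ee hub; apply: (meet E v (arc E (1 / 3))) => //.
    exists (Some (E, true)); first by rewrite /= Ee.
    by exists (1 / 3) => //=; rewrite in_itv /=; lra.
  by exists (1 / 3) => //=; rewrite in_itv /=; lra.
- move=> E v Ee hub; apply: (meet E v (arc E (2 / 3))) => //.
    exists (Some (E, false)); first by rewrite /= Ee.
    by exists (2 / 3) => //=; rewrite in_itv /=; lra.
  by exists (2 / 3) => //=; rewrite in_itv /=; lra.
- move=> u v p pu pv; have [x [xu xv]] := apart (inl u) (inl v) p pu pv.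
  exact: stars_disjoint xu xv.
- move=> E E' p Ee Ee'; rewrite -!partE // => pE pE'.
  have [x] := apart _ _ p pE pE'; rewrite !partE // => -[xE xE'].
  exact: middles_disjoint xE xE'.
move=> v E p Ee pv; rewrite -partE // => pE.
have [x] := apart (inl v) _ p pv pE; rewrite partE // => -[xv xE].
exact: star_middle xv xE.
Qed.

End PlaneDrawing.

Theorem theorem1p5 (R : realType) (V : finType) (e : rel V)
    (e_sym : symmetric e) (e_irrefl : irreflexive e)
    (e_planar : planar R e) :
  (fvs e <= max_frustration_index e)%N.
Proof.
have [pos [arc drawing]] := e_planar.
have [n [NV [NE td]]] := plane_thick_drawing e_sym drawing.
apply: (fvs_le_frustration e_sym e_irrefl).
exact: grid_minor_dual e_irrefl (thick_drawing_minor e_sym e_irrefl td).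
Qed.
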